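(* For every $\beta,T>0$ and $w\in\mathbb{R}$, $$\mathbf{E}\big[K^{\beta;w}_T(0,0)\big]=\sqrt{\frac{2}{\pi T}}\;\mathbf{E}\Bigg[\exp\Bigg(-\frac{T^{3/2}}{2}\bigg(\int_0^1r_t\,\mathrm{d}t-\int_0^\infty\frac{L^a_1(r)^2}{\beta}\,\mathrm{d}a\bigg)-T^{1/2}w\frac{L^0_1(r)}{2}\Bigg)\Bigg],$$ where $r_t$, $t\in[0,1]$ is a reflected Brownian bridge.
   Context: A reflected Brownian bridge $r_t$, $t\in[0,1]$ is the absolute value of a standard Brownian bridge from $0$ to $0$ on $[0,1]$. For a process $Z$ on $[0,T]$ with values in $[0,\infty)$ ($r$ with $T=1$, or reflected Brownian motion), the local time $L^a_T(Z)$, $a\ge0$, is the continuous (in $a$) version of $\lim_{\varepsilon\downarrow0}\frac1\varepsilon\int_0^T\mathbf{1}_{[a,a+\varepsilon)}(Z_t)\,\mathrm{d}t$. Let $W$ be a standard Brownian motion on $[0,\infty)$ and $R^x$ a reflected Brownian motion started at $x\ge0$ (distributed as $|x+B|$, $B$ standard Brownian motion), independent of $W$. The random kernel $K^{\beta;w}_T$ (random through $W$) is $$K^{\beta;w}_T(x,y):=\frac{e^{-(x-y)^2/(2T)}+e^{-(x+y)^2/(2T)}}{\sqrt{2\pi T}}\,\mathbf{E}_{R^x}\Big[\exp\Big(-\int_0^T\frac{R^x_t}{2}\,\mathrm{d}t+\int_0^\infty\frac{L^a_T(R^x)}{\sqrt\beta}\,\mathrm{d}W_a-w\frac{L^0_T(R^x)}{2}\Big)\Big|R^x_T=y\Big],\quad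 x,y\ge 0,$$ where $\mathbf{E}_{R^x}$ is the expectation with respect to $R^x$ only, conditioning on $R^x_T=y$ refers to the reflected Brownian bridge law from $x$ to $y$ on $[0,T]$ (for $x=y=0$: the absolute value of a Brownian bridge from $0$ to $0$ on $[0,T]$), and the Itô integral is understood pathwise as a jointly measurable function of the integrand path and $W$ (Karandikar's pathwise integral), agreeing almost surely with the Itô integral. *)

(* Defs.v *)
From HB Require Import structures.
From mathcomp Require Import all_boot all_order all_algebra.
From mathcomp Require Import all_classical all_reals all_analysis.

Set Implicit Arguments.
Unset Strict Implicit.
Unset Printing Implicit Defensive.

Import Order.TTheory GRing.Theory Num.Theory.
Import numFieldNormedType.Exports.

Local Open Scope classical_set_scope.
Local Open Scope ring_scope.

(* Processes are families indexed by R; only the nonnegative times (resp. the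
   times in [0, T]) are constrained or used. *)

Record brownian_motion (R : realType) (d : measure_display)
    (Omega : measurableType d) (P : probability Omega R)
    (W : R -> {RV P >-> R}) : Prop := BrownianMotion {
  bm_start : forall omega, W 0 omega = 0 ;
  bm_continuous : forall omega,
    {within `[0, +oo[, continuous (fun t : R => W t omega)} ;
  bm_increment : forall (s t : R) (A : set R), 0 <= s -> s < t -> measurable A ->
    P [set omega | A (W t omega - W s omega)]
      = normal_prob 0 (Num.sqrt (t - s)) A ;
  bm_independent : forall (n : nat) (t : nat -> R) (A : nat -> set R),
    0 <= t 0%N -> {homo t : i j / (i <= j)%N >-> i <= j} ->
    (forall i, measurable (A i)) ->
    P [set omega | forall i, (i < n)%N ->
                     A i (W (t i.+1) omega - W (t i) omega)%R]
      = (\prod_(i < n)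
           P [set omega | A i (W (t i.+1) omega - W (t i) omega)%R])%E }.

(* Standard Brownian bridge from 0 to 0 on [0, T]: a continuous process with
   the finite-dimensional laws of t |-> B_t - (t / T) B_T, where B is a Brownian
   motion, possibly living on another probability space. *)
Record brownian_bridge (R : realType) (d : measure_display)
    (Omega : measurableType d) (P : probability Omega R) (T : R)
    (b : R -> {RV P >-> R}) : Prop := BrownianBridge {
  bb_continuous : forall omega,
    {within `[0, T], continuous (fun t : R => b t omega)} ;
  bb_law : exists (d' : measure_display) (Omega' : measurableType d')
      (P' : probability Omega' R) (B : R -> {RV P' >-> R}),
    brownian_motion B /\
    forall (n : nat) (t : 'I_n -> R) (A : 'I_n -> set R),
      (forall i, 0 <= t i <= T) -> (forall i, measurable (A i)) ->
      P [set omega | forall i, A i (b (t i) omega)]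
        = P' [set omega | forall i,
                A i (B (t i) omega - t i / T * B T omega)] }.

Section path_functionals.
Variable R : realType.
Implicit Types (T a t : R) (z f : R -> R).

Definition occupation_density z T a (e : R) : R :=
  e^-1 * \int[lebesgue_measure]_(t in `[0, T]) \1_(`[a, a + e[) (z t).

Definition local_time_limit z T a : R :=
  lim (occupation_density z T a e @[e --> 0^'+]).

(* The local time as a functional of the path: it is the above limit as soon as
   this limit exists at every level a >= 0 and is continuous in a.  This holds
   for almost every path of (bridges of) reflected Brownian motion, so that
   [local_time] yields the version which is continuous in a.  On the remaining
   null set of paths it is set to the constant 0 (also continuous in a). *)
Definition has_local_time z T : Prop :=
  (forall a, 0 <= a -> cvg (occupation_density z T a e @[e --> 0^'+])) /\
  {within `[0, +oo[, continuous (local_time_limit z T)}.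

Definition local_time z T a : R :=
  if `[< has_local_time z T >] then local_time_limit z T a else 0.

(* Karandikar's pathwise integral of f against z (for continuous f).  The
   partition points are tau_0 = 0 and
   tau_{i+1} = inf {s >= tau_i : |f s - f tau_i| >= 2^-n};
   [karandikar_time f n t i] is the minimum of tau_i and t (adjoining t to the
   set makes the infimum that of a nonempty set).
   The limits are those of mathcomp-analysis, equal to 0 when they do not
   exist. *)
Fixpoint karandikar_time f (n : nat) t (i : nat) : R :=
  if i is j.+1 then
    let u := karandikar_time f n t j in
    inf ([set s | u <= s <= t /\ 2^-1 ^+ n <= `|f s - f u|] `|` [set t])
  else 0.

Definition karandikar_sum f z (n : nat) t : R :=
  limn (series (fun i =>
    f (karandikar_time f n t i) *
      (z (karandikar_time f n t i.+1) - z (karandikar_time f n t i)))).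

Definition karandikar_integral f z t : R :=
  limn (fun n => karandikar_sum f z n t).

(* The integral over [0, +oo[. *)
Definition pathwise_integral f z : R :=
  lim (karandikar_integral f z t @[t --> +oo]).

(* [z] is the path of the (reflected) process, [W] that of the integrator. *)
Definition kernel_functional (beta w T : R) (W z : R -> R) : R :=
  expR (- (\int[lebesgue_measure]_(t in `[0, T]) (z t / 2))
        + pathwise_integral (fun a => local_time z T a / Num.sqrt beta) W
        - w * (local_time z T 0 / 2)).

Definition heat_kernel T (u : R) : R :=
  expR (- u ^+ 2 / (2 * T)) / Num.sqrt (2 * pi * T).

End path_functionals.

Section conditioning.
Variables (R : realType) (d : measure_display) (Omega : measurableType d).
Variables (P : probability Omega R) (b : R -> {RV P >-> R}).
Local Open Scope ereal_scope.

(* Expectation of F(|X|), with X the Brownian bridge from x to y on [0, T]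
   built from a standard Brownian bridge b from 0 to 0 on [0, T]. *)
Definition bridge_expectation (T x y : R) (F : (R -> R) -> R) : \bar R :=
  'E_P[fun omega =>
    F (fun t => `|x + (y - x) * (t / T) + b t omega|%R)].

(* Expectation of F(R^x) under the law of the reflected Brownian bridge from x
   to y on [0, T], i.e. of R^x = |x + B| given R^x_T = y.  The conditioning
   event says that x + B ends at y or at - y, which have respective conditional
   probabilities proportional to the Gaussian densities at y - x and - y - x. *)
Definition reflected_bridge_expectation (T x y : R) (F : (R -> R) -> R) :
    \bar R :=
  (heat_kernel T (x - y) / (heat_kernel T (x - y) + heat_kernel T (x + y)))%:E
    * bridge_expectation T x y F +
  (heat_kernel T (x + y) / (heat_kernel T (x - y) + heat_kernel T (x + y)))%:E
    * bridge_expectation T x (- y) F.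

(* The random kernel K, as a function of the path W of the Brownian motion.
   The expectation is only over the space carrying the bridge b, which makes
   the reflected process independent of W.  As the expectation of a positive
   variable, its value lies in [0, +oo]. *)
Definition airy_kernel (beta w T : R) (W : R -> R) (x y : R) : \bar R :=
  ((expR (- (x - y) ^+ 2 / (2 * T)) + expR (- (x + y) ^+ 2 / (2 * T)))
     / Num.sqrt (2 * pi * T))%:E
  * reflected_bridge_expectation T x y (kernel_functional beta w T W).

End conditioning.

Arguments bridge_expectation {R d Omega P} b T x y F.
Arguments reflected_bridge_expectation {R d Omega P} b T x y F.
Arguments airy_kernel {R d Omega P} b beta w T W x y.

Definition reflected_brownian_bridge (R : realType) (d : measure_display)
    (Omega : measurableType d) (P : probability Omega R)
    (r : R -> Omega -> R) : Prop :=
  exists b : R -> {RV P >-> R}, brownian_bridge 1 b /\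
    forall t omega, 0 <= t <= 1 -> r t omega = `|b t omega|.

(* Main.v *)
(** Conditionally on the bridge, the local time f = L / sqrt beta is a
    deterministic continuous integrand for W.  Karandikar's sums of f against W
    are then centred Gaussian variables whose successive differences are of
    order 2^-n in L^2 by the Ito isometry, so they converge almost surely and
    E[exp (int f dW)] = exp (1/2 int f^2).  Tonelli's theorem exchanges the two
    expectations, and Brownian scaling carries the bridge on [0, T] to the one
    on [0, 1].

    Two points are less standard.  Joint measurability of the local time holds
    because it is the right derivative of F(a) = |{t <= T : z_t < a}|, and its
    existence and continuity amount to a uniform Cauchy condition on the slopes
    of F between rational points.  The existence of Brownian local time is never
    used: has_local_time is invariant under scaling, and on paths where it fails
    the value 0 is used on both sides of the identity. *)
Require Import Defs.
From mathcomp Require Import all_boot all_order all_algebra.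
From mathcomp Require Import all_classical all_reals all_analysis.
From mathcomp Require Import measurable_realfun ring lra.

Set Implicit Arguments.
Unset Strict Implicit.
Unset Printing Implicit Defensive.

Import Order.TTheory GRing.Theory Num.Theory.
Import numFieldNormedType.Exports.

Local Open Scope classical_set_scope.
Local Open Scope ring_scope.

(** Totality and measurability shape the proof. The limits in the definitions take the value 0 when
    they do not exist, and Tonelli's theorem needs the kernel functional to be measurable jointly in
    W and in the bridge, exceptional paths included. Hence existence of the local time and the
    comparison of Karandikar's times with a level are rewritten as countably many inequalities, with
    rational points and tolerances 1/(k+1). Continuity of the processes is given on [0, T] or [0,
    +oo[ only. Precomposition with [clamp T] or [Num.max 0] makes the paths continuous on the whole
    line and leaves the functionals unchanged. The integral over all levels reduces to a bounded
    interval because the local time vanishes above the maximum of the path. Powers of T: space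
    scales by T^(1/2) and time by T, so the area of the path picks up T * T^(1/2), the local time T
    / T^(1/2), and the integral of its square over the levels T * T^(1/2). The prefactor is 2 / sqrt
    (2 pi T), the two Gaussian terms of the kernel being equal at x = y = 0. *)

Section measurable_sets.
Context d (S : measurableType d).

Lemma measurable_forall_count (J : countType) (P : J -> S -> Prop) :
  (forall i, measurable [set x | P i x]) -> measurable [set x | forall i, P i x].
Proof.
move=> mP.
rewrite (_ : [set x | forall i, P i x] =
  \bigcap_n (if unpickle n is Some i then [set x | P i x] else setT)); last first.
  apply/seteqP; split => [x Px n _|x Px i]; first by case: unpickle.
  by have := Px (pickle i) I; rewrite pickleK.
by apply: bigcapT_measurable => n; case: unpickle.
Qed.

Lemma measurable_exists_count (J : countType) (P : J -> S -> Prop) :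
  (forall i, measurable [set x | P i x]) -> measurable [set x | exists i, P i x].
Proof.
move=> mP.
rewrite (_ : [set x | exists i, P i x] =
  \bigcup_n (if unpickle n is Some i then [set x | P i x] else set0)); last first.
  apply/seteqP; split => [x [i Px]|x [n _]].
    by exists (pickle i) => //; rewrite pickleK.
  by case: unpickle => // i Px; exists i.
by apply: bigcupT_measurable => n; case: unpickle.
Qed.

Lemma measurable_impl (b : bool) (P : S -> Prop) :
  measurable [set x | P x] -> measurable [set x | b -> P x].
Proof.
move=> mP; case: b.
  by rewrite (_ : [set x | _ ] = [set x | P x])//; apply/seteqP; split => x /=; [exact|].
by rewrite (_ : [set x | _ ] = setT)//; apply/seteqP; split.
Qed.

Context (R : realType).
Implicit Types f g : S -> R.

Lemma measurable_set_le f g : measurable_fun setT f -> measurable_fun setT g ->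
  measurable [set x | f x <= g x].
Proof.
move=> mf mg; rewrite -[X in measurable X]setTI.
exact: (measurable_fun_ler mf mg measurableT (Y := [set true])).
Qed.

Lemma measurable_set_lt f g : measurable_fun setT f -> measurable_fun setT g ->
  measurable [set x | f x < g x].
Proof.
move=> mf mg; rewrite -[X in measurable X]setTI.
exact: (measurable_fun_ltr mf mg measurableT (Y := [set true])).
Qed.

Lemma measurable_fun_set_if (A : set S) f g : measurable A ->
  measurable_fun setT f -> measurable_fun setT g ->
  measurable_fun setT (fun x => if `[< A x >] then f x else g x).
Proof.
move=> mA mf mg; apply: measurable_fun_ifT => //.
apply: (measurable_fun_bool true).
rewrite setTI (_ : _ @^-1` _ = A)//.
by apply/seteqP; split => x /= /asboolP.
Qed.

(** Tolerances 1/(k+1) leave only countable quantifiers in the Cauchy criterion, so that the set of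
    convergence of a sequence of measurable functions is measurable. *)
Lemma cvgn_cauchyP (u : nat -> R) :
  cvgn u <-> forall k : nat, exists N, forall i j : nat, (N <= i)%N -> (N <= j)%N ->
    `|u i - u j| <= k.+1%:R^-1.
Proof.
split.
  move=> /cvg_cauchy/cauchy_ballP cu k.
  have [|[A B] /= [[a _ ha] [b _ hb]] AB] := cu k.+1%:R^-1; first by rewrite invr_gt0.
  exists (maxn a b) => i j; rewrite !geq_max => /andP[ai bi] /andP[aj bj].
  have /AB : (A `*` B) (u i, u j) by split => /=; [exact: ha|exact: hb].
  by rewrite /= /ball /= => /ltW.
move=> H; apply/cauchy_cvgP/cauchy_ballP => e e0.
have [k _ ke] := near_infty_natSinv_lt (PosNum e0).
have [N HN] := H k.
exists ([set u i | i in [set i | (N <= i)%N]], [set u i | i in [set i | (N <= i)%N]]).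
  by split; exists N => // i /= Ni; exists i.
move=> [x y] /= [[i Ni <-] [j Nj <-]].
apply: (le_lt_trans (HN _ _ Ni Nj)).
by have := ke k (leqnn _).
Qed.

Lemma measurable_cvgn (u : nat -> S -> R) :
  (forall n, measurable_fun setT (u n)) -> measurable [set x | cvgn (u ^~ x)].
Proof.
move=> mu.
rewrite (_ : [set x | _] = [set x | forall k : nat, exists N : nat, forall i j : nat,
    (N <= i)%N -> (N <= j)%N -> `|u i x - u j x| <= k.+1%:R^-1]); last first.
  by apply/seteqP; split => x /=; rewrite cvgn_cauchyP.
apply: measurable_forall_count => k; apply: measurable_exists_count => N.
apply: measurable_forall_count => i; apply: measurable_forall_count => j.
do 2 apply: measurable_impl.
apply: measurable_set_le => //.
by apply: measurableT_comp => //; exact: measurable_funB.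
Qed.

Lemma dvg_lim0 (T : Type) (F : set_system T) (f : T -> R) : ~ cvg (f @ F) -> lim (f @ F) = 0.
Proof. by move=> ?; rewrite dvgP. Qed.

(** [limn] is 0 where the sequence diverges. Replacing the sequence by 0 off its measurable set of
    convergence gives a sequence that converges everywhere, to the same value. *)
Lemma measurable_limn (u : nat -> S -> R) :
  (forall n, measurable_fun setT (u n)) -> measurable_fun setT (fun x => limn (u ^~ x)).
Proof.
move=> mu; have mC := measurable_cvgn mu.
pose v n x := if `[< [set x | cvgn (u ^~ x)] x >] then u n x else 0.
apply: (@measurable_fun_cvg _ _ _ setT v).
  by move=> n; exact: measurable_fun_set_if.
move=> x _; rewrite /v; case: asboolP => /= [//|/dvg_lim0 ->].
exact: cvg_cst.
Qed.

End measurable_sets.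

(** * Continuity on subsets and uniform continuity *)

Section continuity.
Context (R : realType).
Implicit Types (f c : R -> R).

Lemma within_continuous_comp (A : set R) f c : {within A, continuous f} ->
  continuous c -> (forall x, A (c x)) -> continuous (f \o c).
Proof.
move=> /subspace_continuousP cf cc Ac x.
apply: cvg_comp (cf _ (Ac x)).
by move=> B; rewrite nbhs_simpl /= => /(cc x); rewrite nbhs_simpl /=; apply: filterS => y; apply; exact: Ac.
Qed.

Lemma continuous_eps f x e : {for x, continuous f} -> 0 < e ->
  exists2 del, 0 < del & forall y, `|x - y| < del -> `|f x - f y| < e.
Proof.
move=> cf e0.
have /cvgrPdist_lt/(_ e e0) [del /= del0 H] := cf.
by exists del => // y xy; exact: H.
Qed.

(** Compactness of [a, b] yields a common radius. Only x is confined to [a, b]: y may leave it,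
    which happens for increments that start near the right end. *)
Lemma continuous_itv_unif f a b e : continuous f -> 0 < e ->
  exists2 del, 0 < del & forall x y, a <= x <= b -> `|x - y| < del ->
    `|f x - f y| < e.
Proof.
move=> cf e0.
have /compact_near_coveringP/near_covering_withinP cab := segment_compact (a := a) (b := b).
have [|del /= del0 H] := cab R 0^'+ (fun del x => forall y, `|x - y| < del -> `|f x - f y| < e).
  move=> x _.
  have [|eta eta0 Heta] := @continuous_eps f x (e / 2) (cf x); first by rewrite divr_gt0.
  exists (ball x (eta / 2), [set del | del < eta / 2]) => /=.
    split; first by apply: nbhsx_ballx; rewrite divr_gt0.
    by apply: nbhs_right_lt; rewrite divr_gt0.
  move=> [x' del] [/= xx' ldel] _ y x'y.
  rewrite -(subrK (f x) (f x')) -addrA (le_lt_trans (ler_normD _ _))//.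
  rewrite (splitr e) ltrD//.
    by rewrite distrC; apply: Heta; rewrite (lt_trans xx')// ltr_pdivrMr// ltr_pMr// ltr1n.
  apply: Heta; rewrite -(subrK x' x) -addrA (le_lt_trans (ler_normD _ _))//.
  by rewrite (splitr eta) ltrD// (lt_trans x'y).
exists (del / 2); first by rewrite divr_gt0.
move=> x y xab; apply: (H (del/2)) => //=.
  by rewrite sub0r normrN gtr0_norm ?divr_gt0// ltr_pdivrMr// ltr_pMr// ltr1n.
by rewrite divr_gt0.
Qed.

End continuity.

(** * Joint measurability of continuous processes *)

Section measurable_process.
Context d (S : measurableType d) (R : realType).

(** Rounding down is deliberate: approximation from the left suits occupation functions, which are
    left-continuous, and the countable rational range suits measurability. *)
Definition grid (n : nat) (t : R) : R := (Num.floor (t * n.+1%:R))%:~R / n.+1%:R.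

Lemma grid_bound n t : grid n t <= t <= grid n t + n.+1%:R^-1.
Proof.
rewrite /grid ler_pdivrMr// floor_le/=.
rewrite -[X in _ + X]mul1r -mulrDl ler_pdivlMr//.
by have /andP[_ /ltW] := floor_itv (t * n.+1%:R); rewrite intrD.
Qed.

Lemma cvg_grid t : grid n t @[n --> \oo] --> t.
Proof.
apply: (@squeeze_cvgr _ _ _ _ (fun n => t - harmonic n) (fun=> t)).
- apply: nearW => n; have /andP[gt tg] := grid_bound n t.
  by rewrite gt andbT lerBlDr.
- rewrite -[X in _ --> X]subr0; apply: cvgB; first exact: cvg_cst.
  exact: cvg_harmonic.
- exact: cvg_cst.
Qed.

(** On each of the countably many slabs where [grid n] is constant, the process reduces to a single
    random variable. *)
Lemma measurable_grid_process (X : R -> S -> R) n : (forall t, measurable_fun setT (X t)) ->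
  measurable_fun setT (fun p : S * R => X (grid n p.2) p.1).
Proof.
move=> mX _ Y mY; rewrite setTI.
rewrite (_ : _ @^-1` Y = [set p | exists k : int,
    (X (k%:~R / n.+1%:R) @^-1` Y `*` `[k%:~R / n.+1%:R, (k + 1)%:~R / n.+1%:R[) p]); last first.
  have gk (t : R) (k : int) : (t \in `[k%:~R / n.+1%:R, (k + 1)%:~R / n.+1%:R[) =
      (Num.floor (t * n.+1%:R) == k).
    by rewrite in_itv/= ler_pdivrMr// ltr_pdivlMr// floor_eq.
  apply/seteqP; split => -[x t] /=.
    by move=> Yx; exists (Num.floor (t * n.+1%:R)); rewrite gk.
  by move=> [k []]; rewrite gk => Yx /eqP tk; rewrite /grid tk.
apply: measurable_exists_count => k; apply: measurableX => //.
by rewrite -[X in measurable X]setTI; exact: mX.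
Qed.

Lemma measurable_continuous_process (X : R -> S -> R) :
  (forall t, measurable_fun setT (X t)) -> (forall s, continuous (X ^~ s)) ->
  measurable_fun setT (fun p : S * R => X p.2 p.1).
Proof.
move=> mX cX.
apply: (@measurable_fun_cvg _ _ _ setT (fun n p => X (grid n p.2) p.1)).
  by move=> n; exact: measurable_grid_process.
move=> [s t] _ /=.
apply: (@continuous_cvg _ _ _ _ _ (fun n => grid n t) (X ^~ s) t (cX s t)).
exact: cvg_grid.
Qed.

End measurable_process.

(** * Occupation functions and local time *)

Section right_derivative.
Context (R : realType).
Implicit Types (F G : R -> R) (a b c x y : R).

(** Lower semicontinuity from the left lets an upper bound on G pass to the supremum of a set.
    Occupation functions have it by left continuity, and their opposites by monotonicity. *)
Definition left_lsc G := forall x e, 0 < e ->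
  exists2 y0, y0 < x & forall y, y0 < y -> y <= x -> G x <= G y + e.

(** Mean value inequality under a bound on right slopes alone, by a continuation argument from a to
    c; the slack e is removed at the start by letting it tend to 0. *)
Lemma right_slope_le G a c C : a <= c -> left_lsc G ->
  (forall x e, a <= x < c -> 0 < e ->
     exists2 del, 0 < del & forall h, 0 < h < del -> G (x + h) - G x <= (C + e) * h) ->
  G c - G a <= C * (c - a).
Proof.
move=> ac lG rG.
suff H e : 0 < e -> G c - G a <= (C + e) * (c - a).
  move: ac; rewrite le_eqVlt => /predU1P[->|ac]; first by rewrite !subrr mulr0.
  apply/ler_addgt0Pr => e e0.
  have ca : 0 < c - a by rewrite subr_gt0.
  have /H : 0 < e / (c - a) by rewrite divr_gt0.
  by rewrite mulrDl divfK ?gt_eqF.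
move=> e0; pose H x := G x - (C + e) * x.
suff : H c <= H a by rewrite /H; lra.
(* The supremum s of S belongs to S by [left_lsc]. If s < c, the bound on the right slope at s
   produces an element of S beyond s. *)
pose S := [set x | a <= x <= c /\ H x <= H a].
have Sa : S a by rewrite /S/= lexx ac.
have ubS : ubound S c by move=> x [/andP[]].
have supS : has_sup S by split; [exists a|exists c].
set s := sup S.
have sa : a <= s by apply: sup_upper_bound.
have sc : s <= c by apply: ge_sup => //; exists a.
have Ss : H s <= H a.
  apply/ler_addgt0Pr => eta eta0.
  have [y0 y0s Hy] := lG s (eta / 2) (divr_gt0 eta0 (ltr0n _ 2)).
  have Ce : 0 < `|C + e| + 1 by rewrite ltr_wpDl.
  (* Within eta / 2 / (|C + e| + 1) of s the linear term of H changes by at most eta / 2; the + 1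
     keeps the denominator positive. *)
  pose y1 := Num.max y0 (s - eta / 2 / (`|C + e| + 1)).
  have y1s : y1 < s.
    by rewrite /y1 gt_max y0s/= ltrBlDr ltrDl !divr_gt0.
  have [y Sy y1y] : exists2 y, S y & y1 < y.
    have [|y Sy] := sup_adherent (eps := s - y1) _ supS; first by rewrite subr_gt0.
    by rewrite -/s subKr => ?; exists y.
  have ys : y <= s by apply: sup_upper_bound.
  have y0y : y0 < y by rewrite (le_lt_trans _ y1y)// /y1 le_max lexx.
  have := Hy _ y0y ys.
  case: Sy => _; rewrite /H => Hya Gsy.
  have : (C + e) * (y - s) <= eta / 2.
    rewrite (le_trans (ler_norm _))// normrM.
    rewrite (@le_trans _ _ ((`|C + e| + 1) * `|y - s|))// ?ler_wpM2r// ?lerDl//.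
    rewrite mulrC -ler_pdivlMr// distrC ger0_norm ?subr_ge0//.
    by rewrite lerBlDr -lerBlDl ltW// (le_lt_trans _ y1y)// /y1 le_max lexx orbT.
  by lra.
move: (sc); rewrite le_eqVlt => /predU1P[<-//|slc].
have [del del0 Hdel] := rG s e (introT andP (conj sa slc)) e0.
pose h := Num.min (del / 2) (c - s).
have h0 : 0 < h by rewrite /h lt_min divr_gt0//= subr_gt0.
have hdel : h < del.
  by rewrite /h gt_min ltr_pdivrMr// ltr_pMr// ltr1n.
have hcs : s + h <= c by rewrite -lerBrDl /h ge_min lexx orbT.
have := Hdel h; rewrite h0 hdel => /(_ isT) Hh.
have : S (s + h).
  split; first by rewrite hcs (le_trans sa)// lerDl ltW.
  by move: Ss; rewrite /H; lra.
by move=> /(sup_upper_bound supS); rewrite -/s; lra.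
Qed.

(* The maximum makes the quotient vanish for [e <= 0], as the occupation density
   of the empty interval [a, a + e[ does. *)
Definition quotient F a e := e^-1 * (F (Num.max a (a + e)) - F a).

Definition slope F a b := (F b - F a) / (b - a).

Lemma quotientE F a e : 0 < e -> quotient F a e = slope F a (a + e).
Proof.
move=> e0; rewrite /quotient /slope [a + e - a]addrC addKr.
by rewrite max_r 1?mulrC// lerDl ltW.
Qed.

Definition right_C1 F :=
  (forall a, 0 <= a -> cvg (quotient F a e @[e --> 0^'+])) /\
  {within `[0, +oo[, continuous (fun a => lim (quotient F a e @[e --> 0^'+]))}.

(** A countable form of [right_C1]. Comparing slopes at two nearby base points captures both halves
    at once: a = a' gives the right derivative, and a different from a' gives its continuity,
    locally uniformly for a in [0, N]. *)
Definition slope_cauchy F := forall N k : nat, exists m : nat, forall a b a' b' : rat,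
  ((0 : R) <= (ratr a : R) <= N%:R) -> (0 : R) <= (ratr a' : R) -> `|(ratr a : R) - (ratr a' : R)| < (m.+1%:R^-1 : R) ->
  (ratr a : R) < (ratr b : R) < (ratr a : R) + (m.+1%:R^-1 : R) ->
  (ratr a' : R) < (ratr b' : R) < (ratr a' : R) + (m.+1%:R^-1 : R) ->
  `|slope F (ratr a) (ratr b) - slope F (ratr a') (ratr b')| <= (k.+1%:R^-1 : R).

Definition slope_cauchyR F := forall N k : nat, exists m : nat, forall a b a' b' : R,
  0 <= a < N%:R -> 0 <= a' -> `|a - a'| < m.+1%:R^-1 ->
  a < b < a + m.+1%:R^-1 ->
  a' < b' < a' + m.+1%:R^-1 ->
  `|slope F a b - slope F a' b'| <= k.+1%:R^-1.

Lemma grid_ge0 n a : 0 <= a -> 0 <= grid n a.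
Proof.
move=> a0; by rewrite /grid divr_ge0// ler0z floor_ge0 mulr_ge0.
Qed.

Lemma grid_ratr n a : exists q : rat, grid n a = ratr q.
Proof.
exists ((Num.floor (a * n.+1%:R))%:~R / n.+1%:R).
by rewrite rmorphM fmorphV /= ratr_int ratr_nat.
Qed.

Context (F : R -> R) (ndF : {homo F : x y / x <= y}) (lF : left_lsc F).

Lemma cvg_left_grid a : F (grid n a) @[n --> \oo] --> F a.
Proof.
apply/cvgrPdist_le => e e0.
have [y0 y0a Hy] := lF a e0.
have : \forall n \near \oo, y0 < grid n a.
  by apply: (cvgr_gt a) => //; exact: cvg_grid.
apply: filterS => n y0n.
have /andP[ga _] := grid_bound n a.
rewrite ger0_norm ?subr_ge0 ?ndF//.
by rewrite lerBlDl Hy.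
Qed.

Lemma slope_cauchyRP : slope_cauchy F -> slope_cauchyR F.
Proof.
move=> scF N k; have [m Hm] := scF N k; exists m => a b a' b' /andP[a0 aN] a'0 aa' /andP[ab ba] /andP[a'b' b'a'].
have cvs x y : x < y -> slope F (grid n x) (grid n y) @[n --> \oo] --> slope F x y.
  move=> xy; apply: cvgM.
    by apply: cvgB; exact: cvg_left_grid.
  apply: cvgV; first by rewrite subr_eq0 gt_eqF.
  by apply: cvgB; exact: cvg_grid.
have cD : `|slope F (grid n a) (grid n b) - slope F (grid n a') (grid n b')| @[n --> \oo] -->
    `|slope F a b - slope F a' b'|.
  by apply: cvg_norm; apply: cvgB; exact: cvs.
apply: (cvgr_to_le cD) => //.
have gtB x y : x < y -> \forall n \near \oo, grid n x < grid n y.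
  move=> xy; near=> n.
  have /andP[gx _] := grid_bound n x.
  rewrite (le_lt_trans gx)//; near: n.
  by apply: (cvgr_gt y) => //; exact: cvg_grid.
have ltD x y : y < x + m.+1%:R^-1 -> \forall n \near \oo, grid n y < grid n x + m.+1%:R^-1.
  move=> xy; near=> n.
  have /andP[gy _] := grid_bound n y.
  rewrite (le_lt_trans gy)// -ltrBlDr; near: n.
  by apply: (cvgr_gt x); rewrite ?ltrBlDr//; exact: cvg_grid.
near=> n.
have [qa Ea] := grid_ratr n a; have [qb Eb] := grid_ratr n b.
have [qa' Ea'] := grid_ratr n a'; have [qb' Eb'] := grid_ratr n b'.
rewrite Ea Eb Ea' Eb'; apply: Hm; rewrite -?Ea -?Eb -?Ea' -?Eb'.
- rewrite grid_ge0//=; have /andP[ga _] := grid_bound n a.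
  by rewrite (le_trans ga)// ltW.
- exact: grid_ge0.
- near: n; apply: (cvgr_lt `|a - a'|) => //.
  by apply: cvg_norm; apply: cvgB; exact: cvg_grid.
- by apply/andP; split; near: n; [exact: gtB|exact: ltD].
- by apply/andP; split; near: n; [exact: gtB|exact: ltD].
Unshelve. all: by end_near. Qed.

Definition rderiv a := lim (quotient F a e @[e --> 0^'+]).

Lemma slope_cauchyR_cvg a : slope_cauchyR F -> 0 <= a -> cvg (quotient F a e @[e --> 0^'+]).
Proof.
move=> scF a0; apply/cauchy_cvgP/cauchy_ballP => eps eps0.
have [k _ ke] := near_infty_natSinv_lt (PosNum eps0).
have [m Hm] := scF (Num.truncn a).+1 k.
have near0 : \forall e \near (0 : R)^'+, 0 < e < m.+1%:R^-1.
  near=> e; apply/andP; split; near: e; first exact: nbhs_right_gt.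
  by apply: nbhs_right_lt; rewrite invr_gt0.
exists (quotient F a @` [set e | 0 < e < m.+1%:R^-1],
        quotient F a @` [set e | 0 < e < m.+1%:R^-1]) => /=.
  by split; apply: filterS near0 => e He; exists e.
move=> [x y] /= [[e /andP[e0 em] <-] [e' /andP[e'0 e'm] <-]].
rewrite /ball/= !quotientE//.
apply: (le_lt_trans _ (ke k (leqnn _))) => /=.
apply: Hm => //; rewrite ?a0 ?truncnS_gt ?subrr ?normr0 ?invr_gt0//.
- by rewrite ltrDl e0/= ltrD2l.
- by rewrite ltrDl e'0/= ltrD2l.
Unshelve. all: by end_near. Qed.

Lemma right_C1_cauchyR : slope_cauchyR F -> right_C1 F.
Proof.
move=> scF; split; first by move=> a; exact: slope_cauchyR_cvg.
apply/subspace_continuousP => a; rewrite /= in_itv/= andbT => a0.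
apply/cvgrPdist_lt => eps eps0.
have [k _ ke] := near_infty_natSinv_lt (PosNum eps0).
have [m Hm] := scF (Num.truncn a).+1 k.
have m0 : (0 : R) < m.+1%:R^-1 by rewrite invr_gt0.
have nb : \forall a' \near a, `|a - a'| < m.+1%:R^-1 by exact: (nbhsx_ballx a).
rewrite near_withinE; apply: filterS nb => a' aa'; rewrite /= in_itv/= andbT => a'0.
apply: (le_lt_trans _ (ke k (leqnn _))) => /=.
have cD : `|quotient F a e - quotient F a' e| @[e --> 0^'+] -->
    `|rderiv a - rderiv a'|.
  apply: cvg_norm; apply: cvgB; exact: slope_cauchyR_cvg.
apply: (cvgr_to_le cD).
near=> e.
have e0 : 0 < e by near: e; exact: nbhs_right_gt.
have em : e < m.+1%:R^-1 by near: e; exact: nbhs_right_lt.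
rewrite !quotientE//; apply: Hm => //.
- by rewrite a0 truncnS_gt.
- by rewrite ltrDl e0/= ltrD2l.
- by rewrite ltrDl e0/= ltrD2l.
Unshelve. all: by end_near. Qed.

(** [right_slope_le] applied to F and to -F places the slope over a short interval within eta of the
    right derivative at its left end; uniform continuity of that derivative on a compact interval
    then compares two base points. *)
Lemma right_C1_cauchy : right_C1 F -> slope_cauchy F.
Proof.
move=> [cF /within_continuous_comp cL] N k.
pose L x := rderiv (Num.max 0 x).
have {}cL : continuous L.
  apply: cL => [x|x]; last by rewrite /= in_itv/= andbT le_max lexx.
  by apply: (@continuous_max _ _ (cst 0) idfun x); [exact: cst_continuous|exact: cvg_id].
have LE x : 0 <= x -> L x = rderiv x by move=> x0; rewrite /L max_r.
(* A third of the tolerance, for three errors: slope against derivative at a, at a', and the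
   derivative at a against that at a'. *)
pose eta : R := k.+1%:R^-1 / 3.
have eta0 : 0 < eta by rewrite divr_gt0 ?invr_gt0.
(* The interval is longer by 1 because a' may exceed N, though by less than 1/(m+1), which is at
   most 1. *)
have [del del0 Hdel] := continuous_itv_unif 0 (N%:R + 1) cL eta0.
have [m _ mdel] := near_infty_natSinv_lt (PosNum del0).
exists m; suff H (a b a' b' : R) : 0 <= a <= N%:R -> 0 <= a' -> `|a - a'| < m.+1%:R^-1 ->
    a < b < a + m.+1%:R^-1 -> a' < b' < a' + m.+1%:R^-1 ->
    `|slope F a b - slope F a' b'| <= k.+1%:R^-1 by move=> a b a' b'; exact: H.
move=> /andP[a0 aN] a'0 aa' /andP[ab ba] /andP[a'b' b'a'].
have {}mdel := mdel m (leqnn _); rewrite /= in mdel.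
have m1 : (m.+1%:R^-1 : R) <= 1 by rewrite invf_le1 ?ler1n.
have key x y : (0 : R) <= x <= N%:R + 1 -> x < y < x + m.+1%:R^-1 -> `|slope F x y - L x| <= eta.
  move=> /andP[x0 xN] /andP[xy yx].
  have yx0 : 0 < y - x by rewrite subr_gt0.
  have Lb t : x <= t < y -> L x - eta < L t < L x + eta.
    move=> /andP[xt ty]; rewrite -ltr_distl distrC; apply: Hdel; first by rewrite x0.
    rewrite distrC ger0_norm ?subr_ge0// (lt_trans _ mdel)// ltrBlDl.
    exact: lt_trans yx.
  have qL t e : x <= t < y -> 0 < e -> exists2 del, 0 < del & forall h, 0 < h < del ->
      `|F (t + h) - F t - L t * h| <= e * h.
    move=> /andP[xt ty] e0; have t0 := le_trans x0 xt.
    have /cvgrPdist_le/(_ e e0) := cF t t0.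
    rewrite near_withinE => -[del1 /= del10 Hd]; exists del1 => // h /andP[h0 hd].
    have := Hd h; rewrite /= sub0r normrN gtr0_norm// => /(_ hd h0).
    rewrite -/(rderiv t) -(LE t t0) quotientE// /slope [t + h - t]addrC addKr => Ht.
    rewrite distrC -ler_pdivrMr//.
    by rewrite -[X in _ / X](gtr0_norm h0) -normf_div mulrBl mulfK ?gt_eqF.
  have U : F y - F x <= (L x + eta) * (y - x).
    apply: right_slope_le => [|//|t e xt e0]; first exact: ltW.
    have [d0 d00 Hd] := qL t e xt e0; exists d0 => // h /[dup] /andP[h0 _] /Hd.
    rewrite ler_norml => /andP[_]; rewrite lerBlDr => /le_trans; apply.
    rewrite -mulrDl ler_pM2r// addrC lerD2r ltW//.
    by have /andP[] := Lb t xt.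
  have V : - F y - - F x <= (eta - L x) * (y - x).
    apply: (@right_slope_le (fun x => - F x)) => [|t e e0|t e xt e0]; first exact: ltW.
      exists (t - 1); first by rewrite ltrBlDr ltrDl.
      by move=> u _ ut; rewrite (le_trans (_ : _ <= - F u))// ?lerN2 ?ndF// lerDl ltW.
    have [d0 d00 Hd] := qL t e xt e0; exists d0 => // h /[dup] /andP[h0 _] /Hd.
    rewrite ler_norml => /andP[+ _].
    have /andP[Lt _] := Lb t xt.
    have : (L x - eta - L t) * h <= 0 by rewrite mulr_le0_ge0 ?ltW// subr_lt0.
    rewrite !mulrDl !mulNr; lra.
  rewrite ler_distl /slope ler_pdivlMr// ler_pdivrMr// U andbT.
  by move: V; rewrite !mulrDl !mulNr; lra.
have Ha : (0 : R) <= a <= N%:R + 1.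
  by apply/andP; split; [exact: a0|apply: (le_trans aN); rewrite lerDl].
have Ha' : (0 : R) <= a' <= N%:R + 1.
  apply/andP; split; first exact: a'0.
  have := ltW aa'; rewrite distrC => /(le_trans (ler_norm _)).
  by rewrite lerBlDr addrC => /le_trans; apply; rewrite lerD.
have ka := key _ _ Ha (introT andP (conj ab ba)).
have ka' := key _ _ Ha' (introT andP (conj a'b' b'a')).
have kL : `|L a - L a'| <= eta.
  by apply: ltW; apply: Hdel => //; rewrite (lt_trans aa').
have -> : slope F a b - slope F a' b' =
  (slope F a b - L a) + (L a - L a') -
  (slope F a' b' - L a') by lra.
rewrite (le_trans (ler_normB _ _))//.
have -> : (k.+1%:R^-1 : R) = eta + eta + eta by rewrite /eta; field.
by rewrite lerD// (le_trans (ler_normD _ _))// lerD.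
Qed.

Lemma right_C1P : right_C1 F <-> slope_cauchy F.
Proof. by split=> [/right_C1_cauchy//|/slope_cauchyRP/right_C1_cauchyR]. Qed.

End right_derivative.

(** * Occupation functions and existence of the local time *)

Section occupation.
Context (R : realType).
Implicit Types (z : R -> R) (T a : R).
Local Notation mu := (@lebesgue_measure R).

(** The strict inequality makes this function of a left-continuous, and makes the occupation time of
    the half-open interval [a, a + e[ an exact increment. *)
Definition occupation z T a : R := fine (mu (`[0, T] `&` [set t | z t < a])).

Context (z : R -> R) (T : R) (mz : measurable_fun `[0, T] z).

Lemma measurable_sublevel a : measurable (`[0, T] `&` [set t | z t < a]).
Proof.
rewrite (_ : [set t | _] = z @^-1` `]-oo, a[); first exact: mz.
by apply/seteqP; split => t /=; rewrite in_itv.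
Qed.

Lemma itv_fin_num (A : set R) : measurable A -> A `<=` `[0, T] -> mu A \is a fin_num.
Proof.
move=> mA AT; rewrite ge0_fin_numE//.
apply: (@le_lt_trans _ _ (mu `[0, T])); first by apply: le_measure; rewrite ?inE.
by rewrite lebesgue_measure_itv/=; case: ifPn => //; rewrite -EFinB ltry.
Qed.

Lemma sublevel_fin_num a : mu (`[0, T] `&` [set t | z t < a]) \is a fin_num.
Proof. by apply: itv_fin_num => [|t []//]; exact: measurable_sublevel. Qed.

Lemma occupation_nd : {homo occupation z T : x y / x <= y}.
Proof.
move=> x y xy; apply: fine_le; try exact: sublevel_fin_num.
apply: le_measure; rewrite ?inE; try exact: measurable_sublevel.
by apply: setIS => t /= /lt_le_trans; apply.
Qed.

(** Continuity from below of Lebesgue measure, along the levels a - 1/(n+1). *)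
Lemma occupation_left_lsc : left_lsc (occupation z T).
Proof.
move=> a e e0.
pose A n := `[0, T] `&` [set t | z t < a - n.+1%:R^-1].
have UA : \bigcup_n A n = `[0, T] `&` [set t | z t < a].
  apply/seteqP; split => [t [n _] [Tt /= zt]|t [Tt /= zt]].
    by split => //=; rewrite (lt_trans zt)// ltrBlDr ltrDl invr_gt0.
  have az : 0 < a - z t by rewrite subr_gt0.
  have [n _ Hn] := near_infty_natSinv_lt (PosNum az).
  by exists n => //; split => //=; have := Hn n (leqnn _) => /=; rewrite ltrBrDl ltrBrDr addrC.
have cA : mu (A n) @[n --> \oo] --> mu (`[0, T] `&` [set t | z t < a]).
  rewrite -UA; apply: nondecreasing_cvg_mu.
  - by move=> n; exact: measurable_sublevel.
  - by apply: bigcupT_measurable => n; exact: measurable_sublevel.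
  - move=> n m nm; apply/subsetPset; apply: setIS => t /= /lt_le_trans; apply.
    by rewrite lerB// lef_pV2 ?posrE// ler_nat.
have /fine_cvgP[_] : mu (A n) @[n --> \oo] --> (occupation z T a)%:E.
  by rewrite /occupation fineK//; exact: sublevel_fin_num.
move=> /cvgrPdist_le/(_ e e0)[n _ Hn].
exists (a - n.+1%:R^-1); first by rewrite ltrBlDr ltrDl invr_gt0.
move=> y ay ya.
have := Hn n (leqnn _) => /=; rewrite -/(occupation z T (a - n.+1%:R^-1)) => H.
rewrite -lerBlDl (le_trans (ler_norm _))// (le_trans _ H)//.
have n0 : (0 : R) < n.+1%:R^-1 by rewrite invr_gt0.
rewrite !ger0_norm ?subr_ge0 ?occupation_nd//; last by rewrite lerBlDr lerDl ltW.
by rewrite lerB// occupation_nd// ltW.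
Qed.

Lemma occupation_densityE a : occupation_density z T a = quotient (occupation z T) a.
Proof.
apply/funext => e; rewrite /occupation_density /quotient; congr (_ * _).
rewrite /Rintegral.
pose B := `[0, T] `&` z @^-1` `[a, a + e[.
have mB : measurable B by exact: mz.
rewrite (@eq_integral _ _ _ mu `[0, T] (fun t => (\1_B t)%:E)); last first.
  by move=> t tT; rewrite !indicE /B in_setI tT.
rewrite integral_indic//.
rewrite (_ : B `&` _ = (`[0, T] `&` [set t | z t < Num.max a (a + e)]) `\`
                        (`[0, T] `&` [set t | z t < a])); last first.
  rewrite /B; apply/seteqP; split => t /=; rewrite !in_itv/= lt_max.
    by move=> [[tT /andP[az ->]] _]; rewrite orbT; split => // -[_]; rewrite ltNge az.
  move=> [[tT /orP[za|zae]] H]; first by exfalso; apply: H.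
  by split => //; split => //; rewrite zae andbT leNgt; apply/negP => za; apply: H.
rewrite measureD; first last.
- by rewrite -ge0_fin_numE//; exact: sublevel_fin_num.
- exact: measurable_sublevel.
- exact: measurable_sublevel.
rewrite (@setIidr _ (`[0, T] `&` [set t | z t < Num.max a (a + e)])); last by apply: setIS => t /= za; rewrite lt_max za.
by rewrite fineB//; exact: sublevel_fin_num.
Qed.

Lemma local_time_limitE a : local_time_limit z T a = rderiv (occupation z T) a.
Proof. by rewrite /local_time_limit occupation_densityE. Qed.

Lemma has_local_timeP : has_local_time z T <-> slope_cauchy (occupation z T).
Proof.
rewrite -(right_C1P occupation_nd occupation_left_lsc) /has_local_time /right_C1.
rewrite (_ : local_time_limit z T = rderiv (occupation z T)); last first.
  by apply/funext => a; exact: local_time_limitE.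
split=> -[H1 H2]; split=> // a /H1; by rewrite occupation_densityE.
Qed.

(** Above a strict bound of the path the occupation function is constant, so its right quotients
    vanish. *)
Lemma local_time_bounded_support M a : (forall t, t \in `[0, T] -> z t < M) -> M <= a ->
  local_time z T a = 0.
Proof.
move=> zM Ma; rewrite /local_time; case: asboolP => // _.
rewrite local_time_limitE /rderiv.
rewrite (_ : quotient _ _ = fun=> 0); first by rewrite lim_cst.
apply/funext => e; rewrite /quotient.
have occT x : M <= x -> occupation z T x = fine (mu `[0, T]).
  move=> Mx; congr (fine (mu _)); apply/seteqP; split => [t []//|t tT].
  by split => //=; rewrite (lt_le_trans (zM _ tT)).
by rewrite !occT ?subrr ?mulr0// le_max Ma.
Qed.

End occupation.

Lemma local_time_continuous (R : realType) (z : R -> R) T :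
  {within `[0, +oo[, continuous (local_time z T)}.
Proof.
rewrite /local_time; case: asboolP => [[]//|_].
by apply: continuous_subspaceT => x; exact: cst_continuous.
Qed.

Lemma eq_occupation_density (R : realType) (z z' : R -> R) T :
  (forall t, t \in `[0, T] -> z t = z' t) -> occupation_density z T = occupation_density z' T.
Proof.
move=> zz'; apply/funext => a; apply/funext => e; congr (_ * _).
by apply: eq_Rintegral => t; rewrite inE/= => /zz' ->.
Qed.

Lemma eq_local_time (R : realType) (z z' : R -> R) T :
  (forall t, t \in `[0, T] -> z t = z' t) -> local_time z T = local_time z' T.
Proof.
by move=> /eq_occupation_density E; rewrite /local_time /has_local_time /local_time_limit E.
Qed.

(** * Joint measurability of the local time *)

Section measurable_local_time.
Context d (S : measurableType d) (R : realType).
Local Notation mu := (@lebesgue_measure R).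

Lemma measurable_Rintegral_ge0 (h : S -> R -> R) (D : set R) : measurable D ->
  (forall s t, D t -> 0 <= h s t) ->
  measurable_fun setT (fun p : S * R => h p.1 p.2) ->
  measurable_fun setT (fun s => \int[mu]_(t in D) h s t).
Proof.
move=> mD h0 mh; rewrite /Rintegral.
apply: (@measurableT_comp _ _ _ _ _ _ (@fine R)); first exact: fine_measurable.
pose g (p : S * R) := if `[< (setT `*` D) p >] then h p.1 p.2 else 0.
have mg : measurable_fun setT g.
  by apply: measurable_fun_set_if => //; exact: measurableX.
rewrite (_ : (fun s => _) = fubini_F mu (EFin \o g)).
  apply: measurable_fun_fubini_tonelli_F; first exact/measurable_EFinP.
  move=> [s t] /=; rewrite /g lee_fin; case: asboolP => //= -[_ Dt]; exact: h0.
apply/funext => s; rewrite /fubini_F integral_mkcond; apply: eq_integral => t _.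
rewrite /= /g /patch; case: asboolP => /= [[_ Dt]|nDt]; first by rewrite mem_set.
by rewrite memNset// => Dt; apply: nDt.
Qed.

Context (Z : S -> R -> R) (T : R).
Hypothesis mZ : measurable_fun setT (fun p : S * R => Z p.1 p.2).

Lemma measurable_path s : measurable_fun setT (Z s).
Proof. exact: (measurable_fun_pair2 s mZ). Qed.

Let mZ0 s : measurable_fun `[0, T] (Z s).
Proof. by apply: measurable_funTS; exact: measurable_path. Qed.

Lemma measurable_occupation :
  measurable_fun setT (fun p : S * R => occupation (Z p.1) T p.2).
Proof.
rewrite /occupation.
apply: (@measurableT_comp _ _ _ _ _ _ (@fine R)); first exact: fine_measurable.
pose A : set ((S * R) * R) := [set q | q.2 \in `[0, T]] `&` [set q | Z q.1.1 q.2 < q.1.2].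
have mA : measurable A.
  apply: measurableI.
    rewrite (_ : [set q | _] = setT `*` [set` `[0, T]]); first exact: measurableX.
    by apply/seteqP; split => -[p t] //= [].
  apply: measurable_set_lt.
    apply: (@measurableT_comp _ _ _ _ _ _ (fun p : S * R => Z p.1 p.2) setT
      (fun q : (S * R) * R => (q.1.1, q.2)) mZ).
    by apply: measurable_fun_pair => //; exact: measurableT_comp.
  exact: measurableT_comp.
rewrite (_ : (fun p => _) = mu \o xsection A); first exact: measurable_fun_xsection.
apply/funext => p /=; congr (mu _); apply/seteqP; split => t /=.
  by rewrite /xsection/= inE.
by rewrite /xsection/= inE.
Qed.

Lemma measurable_occupation_at a : measurable_fun setT (fun s => occupation (Z s) T a).
Proof.
exact: (measurable_fun_pair1 a measurable_occupation).
Qed.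

Lemma measurable_has_local_time : measurable [set s | has_local_time (Z s) T].
Proof.
rewrite (_ : [set s | _] = [set s | slope_cauchy (occupation (Z s) T)]); last first.
  by apply/seteqP; split => s /=; rewrite has_local_timeP.
apply: measurable_forall_count => N; apply: measurable_forall_count => k.
apply: measurable_exists_count => m.
do 4 apply: measurable_forall_count => ?.
do 5 apply: measurable_impl.
apply: measurable_set_le => //; apply: measurableT_comp => //.
have ms u v : measurable_fun setT (fun s => slope (occupation (Z s) T) u v).
  by apply: measurable_funM => //; apply: measurable_funB; exact: measurable_occupation_at.
exact: measurable_funB.
Qed.

Lemma rderiv_limn (F : R -> R) a : cvg (quotient F a e @[e --> 0^'+]) ->
  rderiv F a = limn (fun n => quotient F a n.+1%:R^-1).
Proof.
move=> cF; apply/esym/cvg_lim => //.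
have /cvg_at_rightP := cF; apply; split; first by move=> n; rewrite invr_gt0.
exact: cvg_harmonic.
Qed.

(** [Num.max 0] restricts to the levels at which [has_local_time] provides convergence of the
    quotients. There the right limit may be taken along e = 1/(n+1), which makes it a limit of a
    sequence of measurable functions. *)
Lemma measurable_local_time :
  measurable_fun setT (fun p : S * R => local_time (Z p.1) T (Num.max 0 p.2)).
Proof.
pose g (n : nat) (p : S * R) :=
  quotient (occupation (Z p.1) T) (Num.max 0 p.2) n.+1%:R^-1.
have mg n : measurable_fun setT (g n).
  have mo (h : S * R -> R) : measurable_fun setT h ->
      measurable_fun setT (fun p => occupation (Z p.1) T (h p)).
    move=> mh; apply: (@measurableT_comp _ _ _ _ _ _
      (fun p : S * R => occupation (Z p.1) T p.2) setT (fun p => (p.1, h p)) measurable_occupation).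
    exact: measurable_fun_pair.
  have m0 : measurable_fun [set: S * R] (fun p : S * R => Num.max 0 p.2).
    exact: measurable_maxr.
  apply: measurable_funM => //; apply: measurable_funB; apply: mo => //.
  by apply: measurable_maxr => //; exact: measurable_funD.
rewrite (_ : (fun p => _) = fun p : S * R =>
    if `[< ([set s | has_local_time (Z s) T] `*` setT) p >] then limn (g ^~ p) else 0).
  apply: measurable_fun_set_if => //; last exact: measurable_limn.
  exact: measurableX measurable_has_local_time _.
apply/funext => -[s a] /=; rewrite /local_time.
case: asboolP => h; case: asboolP => //=; [move=> _|by move=> nh; exfalso; apply: nh|by case].
  rewrite local_time_limitE// rderiv_limn//.
  by case: h => h _; rewrite -occupation_densityE//; apply: h; rewrite le_max lexx.
Qed.

Lemma measurable_local_time_at a : 0 <= a ->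
  measurable_fun setT (fun s => local_time (Z s) T a).
Proof.
move=> a0; have := measurable_fun_pair1 a measurable_local_time => /=.
by rewrite max_r.
Qed.

End measurable_local_time.

(** * Scaling of Lebesgue measure and of the local time *)

Section lebesgue_scale.
Context (R : realType) (c : R).
Hypothesis c0 : 0 < c.
Local Notation mu := (@lebesgue_measure R).

Let scale (t : measurableTypeR R) : measurableTypeR R := c * t.

Let mscale_fun : measurable_fun setT scale.
Proof. exact: mulrl_measurable. Qed.

Let nu : {measure set (measurableTypeR R) -> \bar R}.
Proof. by refine (mscale (NngNum (ltW c0)) (pushforward mu scale)); exact: mscale_fun. Defined.

Let nuE B : nu B = (c%:E * mu ((fun t => c * t)%R @^-1` B))%E.
Proof. by []. Qed.

(** The right-hand side is a measure in A which has the correct value on half-open intervals;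
    uniqueness of Lebesgue measure concludes. *)
Lemma lebesgue_measure_scale (A : set R) : measurable A ->
  (mu A = c%:E * mu ((fun t => c * t)%R @^-1` A))%E.
Proof.
move=> mA.
have := @lebesgue_measure_unique R nu.
move=> /(_ _ A mA) -> // _ [[a b] _ <-].
rewrite nuE [X in mu X = _]/= (_ : _ @^-1` _ = `]a / c, b / c]%classic); last first.
  by apply/seteqP; split => t /=; rewrite !in_itv/= ltr_pdivrMr// ler_pdivlMr// mulrC.
rewrite !lebesgue_measure_itv/= !lte_fin ltr_pM2r ?invr_gt0//.
case: ifPn => _; last by rewrite mule0.
by rewrite -!EFinB -EFinM -mulrBl mulrC divfK ?gt_eqF.
Qed.

Lemma ge0_integral_scale (D : set R) (f : R -> \bar R) : measurable D ->
  measurable_fun D f -> (forall t, D t -> (0 <= f t)%E) ->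
  (\int[mu]_(t in D) f t = c%:E * \int[mu]_(t in (fun t => c * t)%R @^-1` D) f (c * t)%R)%E.
Proof.
move=> mD mf f0.
rewrite (@eq_measure_integral _ _ _ _ nu); last first.
  by move=> A mA _; rewrite nuE -lebesgue_measure_scale.
rewrite ge0_integral_mscale//=.
rewrite ge0_integral_pushforward//.
by move=> t; rewrite inE; exact: f0.
Qed.

End lebesgue_scale.

Section scaling.
Context (R : realType).
Implicit Types (F G f : R -> R).

Lemma within_continuous_max0 f :
  {within `[0, +oo[, continuous f} <-> continuous (fun x : R => f (Num.max 0 x)).
Proof.
split.
  move=> cf; apply: (within_continuous_comp cf) => x.
    by apply: (@continuous_max _ _ (cst 0) idfun x); [exact: cst_continuous|exact: cvg_id].
  by rewrite /= in_itv/= le_max lexx.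
move=> cf; apply: (@subspace_eq_continuous _ _ _ (fun x : R => f (Num.max 0 x))).
  by move=> x; rewrite inE/= in_itv/= andbT => x0; rewrite max_r.
exact: continuous_subspaceT.
Qed.

(** The quotient of G at (a, e) is C / k times that of F at (a / k, e / k). Applied with F and G
    exchanged and k inverted, the implication also gives its converse. *)
Lemma right_C1_scale F G (C k : R) : 0 < k -> (forall x, G x = C * F (x / k)) ->
  right_C1 F -> right_C1 G /\ forall a, 0 <= a -> rderiv G a = C / k * rderiv F (a / k).
Proof.
move=> k0 GF [cF coF].
have qG a e : quotient G a e = C / k * quotient F (a / k) (e / k).
  have maxk : Num.max a (a + e) / k = Num.max (a / k) (a / k + e / k).
    by rewrite maxr_pMl ?invr_ge0 ?ltW// mulrDl.
  rewrite /quotient !GF maxk invf_div.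
  by move: (e^-1) (F _) (F _) => i X Y; field; rewrite gt_eqF.
have limG a : 0 <= a -> quotient G a e @[e --> 0^'+] --> C / k * rderiv F (a / k).
  move=> a0; rewrite (_ : quotient G a = fun e => C / k * quotient F (a / k) (e / k)); last first.
    by apply/funext => e; rewrite qG.
  apply: cvgMr; apply/cvg_at_rightP => u [u0 cu].
  have : quotient F (a / k) e @[e --> 0^'+] --> rderiv F (a / k).
    by apply: cF; rewrite divr_ge0// ltW.
  move=> /cvg_at_rightP; apply; split; first by move=> n; rewrite divr_gt0.
  by rewrite -[X in _ --> X](mul0r k^-1); apply: cvgMl.
have rG a : 0 <= a -> rderiv G a = C / k * rderiv F (a / k).
  by move=> a0; apply/cvg_lim => //; exact: limG.
split=> //; split.
  by move=> a a0; apply/cvg_ex; exists (C / k * rderiv F (a / k)); exact: limG.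
apply/within_continuous_max0.
rewrite (_ : (fun x => _) = (fun y => C / k * y) \o ((fun x => rderiv F (Num.max 0 x)) \o (fun x => x / k))).
  move=> x; apply: continuous_comp; last exact: mulrl_continuous.
  apply: continuous_comp; first exact: mulrr_continuous.
  by move/within_continuous_max0 : coF; exact.
apply/funext => x /=; rewrite -/(rderiv _ _) rG ?le_max ?lexx//.
by rewrite maxr_pMl ?invr_ge0 ?ltW// mul0r.
Qed.

Lemma local_time_has (z : R -> R) T a : has_local_time z T ->
  local_time z T a = local_time_limit z T a.
Proof. by move=> h; rewrite /local_time asboolT. Qed.

Lemma local_time_hasn (z : R -> R) T a : ~ has_local_time z T -> local_time z T a = 0.
Proof. by move=> h; rewrite /local_time asboolF. Qed.

(** The substitution in time multiplies occupation times by T, and differentiation in the level,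
    itself rescaled by k, contributes 1 / k. *)
Lemma local_time_scale (z r : R -> R) (T k : R) : 0 < k -> 0 < T ->
  measurable_fun `[0, T] z -> measurable_fun `[0%R : R, 1%R : R] r ->
  (forall t, 0 <= t <= 1 -> z (T * t) = k * r t) ->
  forall a, 0 <= a -> local_time z T a = T / k * local_time r 1 (a / k).
Proof.
move=> k0 T0 mz mr zr.
have occE x : occupation z T x = T * occupation r 1 (x / k).
  rewrite /occupation (lebesgue_measure_scale T0); last exact: measurable_sublevel.
  rewrite fineM//; last first.
    apply: itv_fin_num (1 : R) _ _ _.
      rewrite -[X in measurable X]setTI; apply: mulrl_measurable => //; exact: measurable_sublevel.
    by move=> t /= []; rewrite !in_itv/= pmulr_rge0// -ler_pdivlMl// mulVf ?gt_eqF.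
  congr (_ * fine (lebesgue_measure _)).
  have TE t : (T * t <= T) = (t <= 1) by rewrite -{2}(mulr1 T) ler_pM2l.
  apply/seteqP; split => t /= []; rewrite !in_itv/= pmulr_rge0// TE.
    by move=> t01; rewrite zr// ltr_pdivlMr// mulrC.
  by move=> t01; rewrite zr// ltr_pdivlMr// mulrC.
have occE' x : occupation r 1 x = T^-1 * occupation z T (x / k^-1).
  by rewrite occE mulrA mulVf ?gt_eqF// mul1r invrK mulfK ?gt_eqF.
have C1 (y : R -> R) (U : R) : measurable_fun `[0, U] y -> has_local_time y U <-> right_C1 (occupation y U).
  move=> my; rewrite has_local_timeP// right_C1P//; first exact: occupation_nd.
  exact: occupation_left_lsc.
have hP : has_local_time z T <-> has_local_time r 1.
  rewrite (C1 _ _ mz) (C1 _ _ mr); split => h.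
    by have [] := right_C1_scale _ occE' h; rewrite ?invr_gt0.
  by have [] := right_C1_scale k0 occE h.
move=> a a0; have [hz|hz] := pselect (has_local_time z T).
  have hr := hP.1 hz.
  rewrite (local_time_has a hz) (local_time_has (a / k) hr).
  rewrite (local_time_limitE mz) (local_time_limitE mr).
  by have [_ ->] := right_C1_scale k0 occE ((C1 r 1 mr).1 hr).
have hr : ~ has_local_time r 1 by move=> hr; apply: hz; exact/hP.
by rewrite (local_time_hasn a hz) (local_time_hasn (a / k) hr) mulr0.
Qed.

End scaling.

(** * Karandikar's integral *)

Section karandikar_times.
Context (R : realType).
Implicit Types (f z : R -> R) (t u x M : R).

Definition hitting_set f n u t : set R :=
  [set s | u <= s <= t /\ 2^-1 ^+ n <= `|f s - f u|] `|` [set t].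

Lemma karandikar_timeS f n t i : karandikar_time f n t i.+1 =
  inf (hitting_set f n (karandikar_time f n t i) t).
Proof. by []. Qed.

Lemma half_exp_gt0 n : 0 < 2^-1 ^+ n :> R.
Proof. by rewrite exprn_gt0. Qed.

Lemma hitting_set_lb f n u t : u <= t -> lbound (hitting_set f n u t) u.
Proof. by move=> ut s [[/andP[]]|->]. Qed.

Lemma inf_hitting_bounds f n u t : u <= t -> u <= inf (hitting_set f n u t) <= t.
Proof.
move=> ut; apply/andP; split.
  by apply: lb_le_inf; [exists t; right|exact: hitting_set_lb].
by apply: ge_inf; [exists u; exact: hitting_set_lb|right].
Qed.

Lemma inf_hitting_lt f n u t x : u <= x < inf (hitting_set f n u t) -> u <= t ->
  `|f x - f u| < 2^-1 ^+ n.
Proof.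
move=> /andP[ux xi] ut; rewrite ltNge; apply/negP => H.
have /andP[_ it] := inf_hitting_bounds f n ut.
have : inf (hitting_set f n u t) <= x.
  apply: ge_inf; first by exists u; exact: hitting_set_lb.
  by left; split => //; rewrite ux (le_trans (ltW xi)).
by rewrite leNgt xi.
Qed.

Lemma karandikar_time_bounds f n t i : 0 <= t -> 0 <= karandikar_time f n t i <= t.
Proof.
move=> t0; elim: i => [|i /andP[a b]]; first by rewrite /= lexx.
rewrite karandikar_timeS; have /andP[c ->] := inf_hitting_bounds f n b.
by rewrite (le_trans a).
Qed.

Lemma karandikar_time_nd f n t i : 0 <= t ->
  karandikar_time f n t i <= karandikar_time f n t i.+1.
Proof.
move=> /(karandikar_time_bounds f n i)/andP[_ b].
by rewrite karandikar_timeS; have /andP[] := inf_hitting_bounds f n b.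
Qed.

Lemma karandikar_time_homo f n t : 0 <= t ->
  {homo karandikar_time f n t : i j / (i <= j)%N >-> i <= j}.
Proof. by move=> t0; apply/nondecreasing_seqP => i; exact: karandikar_time_nd. Qed.

Lemma eq_karandikar_time f g n t : 0 <= t -> (forall x, 0 <= x -> f x = g x) ->
  karandikar_time f n t =1 karandikar_time g n t.
Proof.
move=> t0 fg; elim=> [//|i IH].
have /andP[a b] := karandikar_time_bounds g n i t0.
rewrite !karandikar_timeS IH; congr inf; rewrite /hitting_set; congr (_ `|` _).
by apply/seteqP; split => s /= [/andP[us st]]; rewrite us st !fg// (le_trans a).
Qed.

(** By uniform continuity f needs a time at least eta to move by 2^-n, so each step has length at
    least eta until the horizon t is reached. *)
Lemma karandikar_time_stop f n t : continuous f -> 0 <= t ->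
  exists N, forall i, (N <= i)%N -> karandikar_time f n t i = t.
Proof.
move=> cf t0.
have [eta eta0 Heta] := continuous_itv_unif 0 t cf (half_exp_gt0 n).
have step i : Num.min (i%:R * eta) t <= karandikar_time f n t i.
  elim: i => [|i IH]; first by rewrite mul0r ge_min lexx.
  have /andP[a b] := karandikar_time_bounds f n i t0.
  rewrite karandikar_timeS; apply: lb_le_inf; first by exists t; right.
  move=> s [|->]; last by rewrite ge_min lexx orbT.
  move=> [/andP[us st] H].
  have := IH; rewrite ge_min => /orP[IH1|tu]; last first.
    by rewrite ge_min (le_trans tu us) orbT.
  rewrite ge_min; apply/orP; left.
  rewrite -natr1 mulrDl mul1r leNgt; apply/negP => su.
  have K : `|karandikar_time f n t i - s| < eta.
    by rewrite distrC ger0_norm ?subr_ge0// ltrBlDr (lt_le_trans su)// addrC lerD2l.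
  have := Heta _ s (introT andP (conj a b)) K.
  by rewrite distrC ltNge H.
exists (Num.truncn (t / eta)).+1 => i Ni; apply/eqP; rewrite eq_le.
have /andP[_ ->] := karandikar_time_bounds f n i t0.
apply: le_trans (step i); rewrite le_min lexx andbT -ler_pdivrMr//.
by rewrite (le_trans (ltW (truncnS_gt _)))// ler_nat.
Qed.

Lemma karandikar_time_cover f n t N x : 0 <= t -> karandikar_time f n t N = t ->
  0 <= x < t -> exists2 i, (i < N)%N & karandikar_time f n t i <= x < karandikar_time f n t i.+1.
Proof.
move=> t0 tN /andP[x0 xt].
have : x < karandikar_time f n t N by rewrite tN.
elim: N {tN} => [|N IH xN]; first by rewrite /= ltNge x0.
have [xN'|Nx] := ltP x (karandikar_time f n t N); last by exists N => //; rewrite Nx.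
by have [i iN Hi] := IH xN'; exists i => //; exact: ltnW.
Qed.

Definition karandikar_partial f z n t k : R :=
  \sum_(i < k) f (karandikar_time f n t i) *
    (z (karandikar_time f n t i.+1) - z (karandikar_time f n t i)).

Lemma karandikar_partialS f z n t k : karandikar_partial f z n t k.+1 =
  karandikar_partial f z n t k + f (karandikar_time f n t k) *
    (z (karandikar_time f n t k.+1) - z (karandikar_time f n t k)).
Proof. by rewrite /karandikar_partial big_ord_recr. Qed.

Lemma karandikar_sum_stop f z n t N :
  (forall i, (N <= i)%N -> karandikar_time f n t i = t) ->
  forall k, (N <= k)%N -> karandikar_sum f z n t = karandikar_partial f z n t k.
Proof.
move=> HN; rewrite /karandikar_sum.
have E k : (N <= k)%N -> karandikar_partial f z n t k = karandikar_partial f z n t N.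
  move=> /subnK <-; elim: (k - N)%N => [//|m IH].
  rewrite addSn karandikar_partialS IH.
  by rewrite !HN ?subrr ?mulr0 ?addr0// -?addSn leq_addl.
move=> k Nk; rewrite E//.
apply/cvg_lim => //; apply: cvg_near_cst; exists N => // m /= Nm.
by rewrite /series/= big_mkord -/(karandikar_partial f z n t m) E.
Qed.

End karandikar_times.

(** * Integrands of bounded support *)

Section karandikar_support.
Context (R : realType).
Implicit Types (f z : R -> R) (t u x M : R).

Lemma eq_karandikar_integral f g z z' t : 0 <= t -> (forall x, 0 <= x -> f x = g x) ->
  (forall x, 0 <= x -> z x = z' x) ->
  karandikar_integral f z t = karandikar_integral g z' t.
Proof.
move=> t0 fg zz'; rewrite /karandikar_integral.
suff -> : (fun n => karandikar_sum f z n t) = (fun n => karandikar_sum g z' n t) by [].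
apply/funext => n; rewrite /karandikar_sum.
suff -> : (fun i => f (karandikar_time f n t i) *
      (z (karandikar_time f n t i.+1) - z (karandikar_time f n t i))) =
    (fun i => g (karandikar_time g n t i) *
      (z' (karandikar_time g n t i.+1) - z' (karandikar_time g n t i))) by [].
apply/funext => i.
have tb j : 0 <= karandikar_time g n t j by have /andP[] := karandikar_time_bounds g n j t0.
by rewrite !(eq_karandikar_time n t0 fg) fg// !zz'.
Qed.

(** The identity covers divergent sequences as well: one diverges exactly when the other does, and
    then both limits are 0. *)
Lemma lim_subr0 (u v : nat -> R) : u n - v n @[n --> \oo] --> (0 : R) -> limn u = limn v.
Proof.
move=> uv.
have E (a b : nat -> R) (l : R) : a n - b n @[n --> \oo] --> (0 : R) ->
    a n @[n --> \oo] --> l -> b n @[n --> \oo] --> l.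
  move=> ab al; rewrite (_ : b = fun n => a n - (a n - b n)); last first.
    by apply/funext => n; rewrite subKr.
  by have := cvgB al ab; rewrite subr0; exact.
have vu : v n - u n @[n --> \oo] --> (0 : R).
  have -> : (fun n => v n - u n) = (fun n => - (u n - v n)).
    by apply/funext => n; rewrite opprB.
  by have := cvgN uv; rewrite oppr0; exact.
have [cu|ncu] := pselect (cvgn u).
  by apply/esym/cvg_lim => //; exact: (E u v (limn u) uv cu).
have ncv : ~ cvgn v.
  by move=> cv; apply: ncu; apply/cvg_ex; exists (limn v); exact: (E v u (limn v) vu cv).
by rewrite (dvg_lim0 ncu) (dvg_lim0 ncv).
Qed.

Context (f : R -> R) (M : R) (cf : continuous f) (M0 : 0 <= M).
Hypothesis fM : forall x, M <= x -> f x = 0.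

(** Either f moves by 2^-n before M, at a time that is the same for the horizons t and M, or it does
    not. In the second case comparison with f M = 0 gives |f u| < 2^-n, so f, which vanishes beyond
    M, never moves that far afterwards, and both times run to their horizons. *)
Lemma inf_hitting_support n u t : u <= M -> M <= t ->
  (inf (hitting_set f n u t) = inf (hitting_set f n u M) /\ inf (hitting_set f n u t) <= M) \/
  [/\ inf (hitting_set f n u t) = t, inf (hitting_set f n u M) = M & `|f u| < 2^-1 ^+ n].
Proof.
move=> uM Mt; have ut := le_trans uM Mt.
have [[h [/andP[uh hM] Hh]]|nohit] :=
    pselect (exists s, u <= s <= M /\ 2^-1 ^+ n <= `|f s - f u|).
  have iM : inf (hitting_set f n u t) <= M.
    rewrite (le_trans _ hM)//; apply: ge_inf; first by exists u; exact: hitting_set_lb.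
    by left; split => //; rewrite uh (le_trans hM).
  left; split => //; apply/eqP; rewrite eq_le; apply/andP; split.
    apply: lb_le_inf; first by exists M; right.
    move=> s [[/andP[us sM] Hs]|->//].
    apply: ge_inf; first by exists u; exact: hitting_set_lb.
    by left; split => //; rewrite us (le_trans sM).
  apply: lb_le_inf; first by exists t; right.
  have lbM s : hitting_set f n u M s -> inf (hitting_set f n u M) <= s.
    by move=> ?; apply: ge_inf => //; exists u; exact: hitting_set_lb.
  move=> s [[/andP[us st] Hs]|->]; last first.
    by rewrite (le_trans _ Mt)//; apply: lbM; right.
  have [sM|/ltW Ms] := leP s M; first by apply: lbM; left; split => //; rewrite us sM.
  by rewrite (le_trans _ Ms)//; apply: lbM; right.
have nohitM s : u <= s <= M -> `|f s - f u| < 2^-1 ^+ n.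
  by move=> usM; rewrite ltNge; apply/negP => Hs; apply: nohit; exists s.
have fu : `|f u| < 2^-1 ^+ n.
  by have := nohitM M; rewrite uM lexx fM// sub0r normrN; exact.
have infE s : M <= s -> inf (hitting_set f n u s) = s.
  move=> Ms; apply/eqP; rewrite eq_le; apply/andP; split.
    by have /andP[] := inf_hitting_bounds f n (le_trans uM Ms).
  apply: lb_le_inf; first by exists s; right.
  move=> x [[/andP[ux xs] Hx]|->//].
  exfalso; move: Hx; apply/negP; rewrite -ltNge.
  have [xM|/ltW Mx] := leP x M; first by apply: nohitM; rewrite ux.
  by rewrite fM// sub0r normrN.
by right; split => //; exact: infE.
Qed.

(** The partitions for the horizons t and M agree until they jump to their horizons. That jump is
    the only source of discrepancy, f u * (z t - z M) with |f u| < 2^-n, and later increments are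
    zero. *)
Lemma karandikar_time_partial_support z n t k : M <= t ->
  (karandikar_time f n t k = karandikar_time f n M k /\ karandikar_time f n t k <= M /\ karandikar_partial f z n t k = karandikar_partial f z n M k) \/
  (karandikar_time f n t k = t /\ karandikar_time f n M k = M /\ `|karandikar_partial f z n t k - karandikar_partial f z n M k| <=
     2^-1 ^+ n * `|z t - z M|).
Proof.
move=> Mt; have t0 := le_trans M0 Mt; elim: k => [|k IH].
  by left; rewrite /= /karandikar_partial !big_ord0.
rewrite !karandikar_partialS.
case: IH => [[tM [tkM pM]]|[kt [kM pM]]]; last first.
  right; have kt' : karandikar_time f n t k.+1 = t.
    apply/eqP; rewrite eq_le; have /andP[_ ->] := karandikar_time_bounds f n k.+1 t0.
    by have := karandikar_time_nd f n k t0; rewrite kt.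
  have kM' : karandikar_time f n M k.+1 = M.
    apply/eqP; rewrite eq_le; have /andP[_ ->] := karandikar_time_bounds f n k.+1 M0.
    by have := karandikar_time_nd f n k M0; rewrite kM.
  by rewrite kt' kM' kt kM !subrr !mulr0 !addr0.
rewrite !karandikar_timeS -tM -pM.
have [[e1 e2]|[e1 e1' fu]] := inf_hitting_support n tkM Mt.
  by left; rewrite e1; split => //; split => //; rewrite -e1.
right; rewrite e1 e1'; split => //; split => //.
by rewrite opprD addrACA subrr add0r -mulrBr normrM opprB addrA subrK ler_wpM2r// ltW.
Qed.

(** At level n the sums for the two horizons differ by at most 2^-n * |z t - z M|. By [lim_subr0]
    this settles the case of divergence too. *)
Lemma karandikar_integral_support z t : M <= t ->
  karandikar_integral f z t = karandikar_integral f z M.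
Proof.
move=> Mt; have t0 := le_trans M0 Mt.
apply: lim_subr0; apply/cvgrPdist_le => e e0.
have : 2^-1 ^+ n * `|z t - z M| @[n --> \oo] --> (0 : R).
  have : 2^-1 ^+ n @[n --> \oo] --> (0 : R) by apply: cvg_expr; rewrite ger0_norm// invf_lt1// ltr1n.
  by move=> H; have := cvgM H (cvg_cst `|z t - z M|); rewrite mul0r; exact.
move=> /cvgrPdist_le/(_ e e0); apply: filterS => n.
rewrite !sub0r !normrN ger0_norm; last by rewrite mulr_ge0// ltW// half_exp_gt0.
apply: le_trans.
have [N1 HN1] := karandikar_time_stop n cf t0.
have [N2 HN2] := karandikar_time_stop n cf M0.
rewrite (karandikar_sum_stop z HN1 (leq_maxl N1 N2)) (karandikar_sum_stop z HN2 (leq_maxr N1 N2)).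
have [[_ [_ ->]]|[_ [_ //]]] := karandikar_time_partial_support z n (maxn N1 N2) Mt.
by rewrite subrr normr0 mulr_ge0// ltW// half_exp_gt0.
Qed.

Lemma pathwise_integral_support z : pathwise_integral f z = karandikar_integral f z M.
Proof.
apply/cvg_lim => //; apply: cvg_near_cst.
by exists M; split; [exact: num_real|move=> t /ltW/karandikar_integral_support].
Qed.

(** The limit over real horizons becomes one over integers, a sequence that is the same for all
    integrands; measurability follows although M varies with the sample. *)
Lemma pathwise_integral_limn z :
  pathwise_integral f z = limn (fun m => karandikar_integral f z m%:R).
Proof.
rewrite pathwise_integral_support; apply/esym/cvg_lim => //; apply: cvg_near_cst.
exists (Num.truncn M).+1 => // m /= Mm; apply: karandikar_integral_support.
by rewrite (le_trans (ltW (truncnS_gt _)))// ler_nat.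
Qed.

End karandikar_support.

Lemma eq_pathwise_integral (R : realType) (f g z z' : R -> R) :
  (forall x, 0 <= x -> f x = g x) -> (forall x, 0 <= x -> z x = z' x) ->
  pathwise_integral f z = pathwise_integral g z'.
Proof.
move=> fg zz'; rewrite /pathwise_integral.
have E : {near +oo, karandikar_integral f z =1 karandikar_integral g z'}.
  exists 0; split; first exact: num_real.
  by move=> t /ltW t0; exact: eq_karandikar_integral.
by congr lim; apply/seteqP; split; apply: near_eq_cvg => //; apply: filterS E.
Qed.

(** * Measurability of Karandikar's times and integral *)

Section measurable_karandikar.
Context d (S : measurableType d) (R : realType).

Lemma measurable_fun_gt (g : S -> R) : (forall c, measurable [set s | c < g s]) ->
  measurable_fun setT g.
Proof.
move=> H; apply: (measurability _ (RGenOInfty.measurableE R)) => _ [_ [c ->] <-].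
rewrite setTI (_ : _ @^-1` _ = [set s | c < g s])//.
by apply/seteqP; split => s /=; rewrite in_itv/= andbT.
Qed.

(** The infimum exceeds c >= u when f stays strictly within 2^-n of f u on [u, c]. Compactness turns
    strictness into a margin 1/(k+1), and writing the points of [u, c] as u + q (c - u) makes the
    set of rational q independent of the random time u. *)
Lemma inf_hitting_gtP (f : R -> R) n u t c : continuous f -> u <= t ->
  c < inf (hitting_set f n u t) <->
  c < t /\ (c < u \/ (u <= c /\ exists k : nat, forall q : rat,
     (0 : R) <= (ratr q : R) <= 1 ->
     `|f (u + (ratr q : R) * (c - u)) - f u| + k.+1%:R^-1 <= 2^-1 ^+ n)).
Proof.
move=> cf ut; have /andP[ui it] := inf_hitting_bounds f n ut; split.
  move=> ci; split; first exact: lt_le_trans it.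
  have [uc|] := leP u c; last by left.
  right; split => //.
  have [|x] := @EVT_max R (fun x => `|f x - f u|) u c uc.
    apply: continuous_subspaceT => x.
    by apply: cvg_norm; apply: cvgB; [exact: cf|exact: cvg_cst].
  rewrite in_itv/= => /andP[ux xc] Hx.
  have fx : `|f x - f u| < 2^-1 ^+ n.
    by apply: inf_hitting_lt ut; rewrite ux (le_lt_trans xc).
  have e0 : 0 < 2^-1 ^+ n - `|f x - f u| by rewrite subr_gt0.
  have [k _ /(_ k (leqnn _))/= ke] := near_infty_natSinv_lt (PosNum e0).
  exists k => q /andP[q0 q1].
  rewrite -lerBrDr; apply: (le_trans (Hx _ _)); last by rewrite lerBrDr -lerBrDl ltW.
  rewrite in_itv/= lerDl mulr_ge0 ?subr_ge0//= -lerBrDl.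
  by rewrite ler_piMl// subr_ge0.
move=> [ct [cu|[uc [k Hk]]]]; first exact: lt_le_trans ui.
have Hx x : u <= x <= c -> `|f x - f u| + k.+1%:R^-1 <= 2^-1 ^+ n.
  move=> /andP[ux xc].
  have [cu|cu] := eqVneq c u.
    have -> : x = u by apply/eqP; rewrite eq_le ux -{1}cu xc.
    by have := Hk 0; rewrite rmorph0 mul0r addr0 lexx ler01; exact.
  have cu0 : 0 < c - u by rewrite subr_gt0 lt_neqAle eq_sym cu.
  pose th := (x - u) / (c - u).
  have th0 : 0 <= th by rewrite divr_ge0// ?subr_ge0// ltW.
  have th1 : th <= 1 by rewrite ler_pdivrMr// mul1r lerB.
  have -> : x = u + th * (c - u) by rewrite divfK ?gt_eqF// subrKC.
  pose h a := `|f (u + a * (c - u)) - f u| + k.+1%:R^-1.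
  have ch : continuous h.
    move=> a; apply: cvgD; last exact: cvg_cst.
    apply: cvg_norm; apply: cvgB; last exact: cvg_cst.
    apply: (@continuous_cvg _ _ _ _ _ (fun a => u + a * (c - u)) f); first exact: cf.
    by apply: cvgD; [exact: cvg_cst|exact: mulrr_continuous].
  have cg : h (grid n th) @[n --> \oo] --> h th.
    by apply: (@continuous_cvg _ _ _ _ _ (fun n => grid n th) h); [exact: ch|exact: cvg_grid].
  apply: (cvgr_to_le cg); apply: nearW => m /=.
  have [q E] := grid_ratr m th; rewrite /h E; apply: Hk; rewrite -E.
  have /andP[gth _] := grid_bound m th.
  by rewrite grid_ge0//= (le_trans gth).
(* The margin survives slightly to the right of c, which makes the infimum strictly larger than
   c. *)
have k0 : (0 : R) < k.+1%:R^-1 by rewrite invr_gt0.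
have [del del0 Hdel] := continuous_eps (cf c) k0.
apply: (@lt_le_trans _ _ (Num.min (c + del) t)); first by rewrite lt_min ltrDl del0.
apply: lb_le_inf; first by exists t; right.
move=> s [[/andP[us st] Hs]|->]; last by rewrite ge_min lexx orbT.
rewrite ge_min leNgt; apply/orP; left; apply/negP => sc.
move: Hs; apply/negP; rewrite -ltNge.
have [sc'|cs] := leP s c.
  by have := Hx s; rewrite us sc' => /(_ isT); apply: lt_le_trans; rewrite ltrDl.
have := Hx c; rewrite uc lexx => /(_ isT); apply: lt_le_trans.
rewrite -(subrK (f c) (f s)) -addrA (le_lt_trans (ler_normD _ _))//.
rewrite (addrC `|f c - f u|) ltrD2r distrC.
by apply: Hdel; rewrite distrC gtr0_norm ?subr_gt0// ltrBlDl.
Qed.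

Context (f z : S -> R -> R).
Hypothesis mf : measurable_fun setT (fun p : S * R => f p.1 p.2).
Hypothesis mz : measurable_fun setT (fun p : S * R => z p.1 p.2).
Hypothesis cf : forall s, continuous (f s).

Lemma measurable_process_at (g : S -> R -> R) (u : S -> R) :
  measurable_fun setT (fun p : S * R => g p.1 p.2) -> measurable_fun setT u ->
  measurable_fun setT (fun s => g s (u s)).
Proof.
move=> mg mu; apply: (@measurableT_comp _ _ _ _ _ _ (fun p : S * R => g p.1 p.2) setT
  (fun s => (s, u s)) mg).
exact: measurable_fun_pair.
Qed.

Lemma measurable_karandikar_time n t i : 0 <= t ->
  measurable_fun setT (fun s => karandikar_time (f s) n t i).
Proof.
move=> t0; elim: i => [|i IH]; first exact: measurable_cst.
apply: measurable_fun_gt => c.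
pose u s := karandikar_time (f s) n t i.
have ut s : u s <= t by have /andP[] := karandikar_time_bounds (f s) n i t0.
rewrite (_ : [set s | _] = [set s | c < t] `&` ([set s | c < u s] `|` ([set s | u s <= c] `&`
  [set s | exists k : nat, forall q : rat, (0 : R) <= (ratr q : R) <= 1 ->
     `|f s (u s + (ratr q : R) * (c - u s)) - f s (u s)| + k.+1%:R^-1 <= 2^-1 ^+ n]))); last first.
  by apply/seteqP; split => s /=; rewrite -/(hitting_set _ _ _ _) -/(u s) inf_hitting_gtP.
apply: measurableI; first exact: measurable_set_lt.
apply: measurableU; first exact: measurable_set_lt.
apply: measurableI; first exact: measurable_set_le.
apply: measurable_exists_count => k; apply: measurable_forall_count => q.
apply: measurable_impl; apply: measurable_set_le => //.
apply: measurable_funD => //; apply: measurableT_comp => //.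
apply: measurable_funB; apply: measurable_process_at => //.
by apply: measurable_funD => //; apply: measurable_funM => //; exact: measurable_funB.
Qed.

Lemma measurable_karandikar_integral t : 0 <= t ->
  measurable_fun setT (fun s => karandikar_integral (f s) (z s) t).
Proof.
move=> t0; apply: measurable_limn => n; apply: measurable_limn => k.
rewrite /series/=; apply: measurable_sum => i.
have mt j := @measurable_karandikar_time n t j t0.
by apply: measurable_funM; [exact: (measurable_process_at mf (mt i))|apply: measurable_funB;
  [exact: (measurable_process_at mz (mt i.+1))|exact: (measurable_process_at mz (mt i))]].
Qed.

Lemma measurable_pathwise_integral :
  (forall s, exists2 M, 0 <= M & forall x, M <= x -> f s x = 0) ->
  measurable_fun setT (fun s => pathwise_integral (f s) (z s)).
Proof.
move=> fM; rewrite (_ : (fun s => _) =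
    fun s => limn (fun m => karandikar_integral (f s) (z s) m%:R)); last first.
  by apply/funext => s; have [M M0 HM] := fM s; rewrite (pathwise_integral_limn (@cf s) M0 HM).
by apply: measurable_limn => m; exact: measurable_karandikar_integral.
Qed.

End measurable_karandikar.

(** * Equality of weighted laws *)

Section weighted_transfer.
Context d d1 d2 (T : measurableType d) (O1 : measurableType d1) (O2 : measurableType d2)
  (R : realType) (mu1 : {measure set O1 -> \bar R}) (mu2 : {measure set O2 -> \bar R}).
Context (X1 : O1 -> T) (X2 : O2 -> T) (y1 : O1 -> R) (y2 : O2 -> R).
Hypothesis (mX1 : measurable_fun setT X1) (mX2 : measurable_fun setT X2).
Hypothesis (my1 : measurable_fun setT y1) (my2 : measurable_fun setT y2).
Hypothesis (y1_ge0 : forall x, 0 <= y1 x) (y2_ge0 : forall x, 0 <= y2 x).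
Hypothesis H : forall A : set T, measurable A ->
  (\int[mu1]_x (y1 x * \1_A (X1 x))%:E = \int[mu2]_x (y2 x * \1_A (X2 x))%:E)%E.

Import HBNNSimple.

Let nnsfun_integral d' (O : measurableType d') (mu : {measure set O -> \bar R}) (X : O -> T)
  (y : O -> R) (g : {nnsfun T >-> R}) : measurable_fun setT X -> measurable_fun setT y ->
  (forall x, 0 <= y x) ->
  (\int[mu]_x (y x * g (X x))%:E =
   \sum_(r <- finmap.enum_fset (fset_set (range g))) r%:E * \int[mu]_x (y x * \1_(g @^-1` [set r]) (X x))%:E)%E.
Proof.
move=> mX my y0.
have mE r : measurable_fun setT (fun x => y x * \1_(g @^-1` [set r]) (X x)).
  apply: measurable_funM => //.
  exact: (measurableT_comp (measurable_indic (measurable_sfunP g (measurable_set1 r)))).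
have ge0 r x : 0 <= r * (y x * \1_(g @^-1` [set r]) (X x)).
  rewrite indicE; case: (boolP (X x \in _)) => [|_]; last by rewrite !mulr0.
  by rewrite inE/= => <-; rewrite mulr1 mulr_ge0// fun_ge0.
transitivity (\int[mu]_x \sum_(r <- finmap.enum_fset (fset_set (range g))) (r * (y x * \1_(g @^-1` [set r]) (X x)))%:E)%E.
  apply: eq_integral => x _; rewrite sumEFin; congr EFin.
  rewrite fimfunE fsbig_finite//= mulr_sumr.
  by apply: eq_bigr => r _; rewrite mulrCA.
rewrite ge0_integral_sum//; last 2 first.
- by move=> r; apply/measurable_EFinP; exact: measurable_funM.
- by move=> r x _; rewrite lee_fin.
apply: eq_big_seq => r; rewrite in_fset_set// inE => -[u _ gu].
under eq_integral do rewrite EFinM.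
rewrite ge0_integralZl//; first exact/measurable_EFinP.
- by move=> x _; rewrite lee_fin mulr_ge0// indicE.
- by rewrite lee_fin -gu fun_ge0.
Qed.

(** Agreement on indicators extends to nonnegative functions through simple functions and monotone
    convergence. The weights serve three purposes: 1 for equality of laws, a density for the normal
    law, and the product of the remaining factors for independence. *)
Lemma weighted_transfer (g : T -> R) : measurable_fun setT g -> (forall x, 0 <= g x) ->
  (\int[mu1]_x (y1 x * g (X1 x))%:E = \int[mu2]_x (y2 x * g (X2 x))%:E)%E.
Proof.
move=> mg g0.
have mEg : measurable_fun setT (EFin \o g) by exact/measurable_EFinP.
pose f_ := nnsfun_approx measurableT mEg.
have lims d' (O : measurableType d') (mu : {measure set O -> \bar R}) (X : O -> T) (y : O -> R) :
    measurable_fun setT X -> measurable_fun setT y -> (forall x, 0 <= y x) ->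
    (\int[mu]_x (y x * g (X x))%:E = limn (fun n => \int[mu]_x (y x * f_ n (X x))%:E))%E.
  move=> mX my y0; rewrite -monotone_convergence//.
  - apply: eq_integral => x _; apply/esym/cvg_lim => //.
    rewrite (_ : (fun n => _) = (fun n => (y x)%:E * (f_ n (X x))%:E)%E); last first.
      by apply/funext => n; rewrite EFinM.
    rewrite EFinM; apply: cvgeZl => //.
    by apply: cvg_nnsfun_approx => // t _; rewrite lee_fin.
  - move=> n; apply/measurable_EFinP; apply: measurable_funM => //.
    exact: measurableT_comp.
  - by move=> n x _; rewrite lee_fin mulr_ge0// fun_ge0.
  - move=> x _ m n mn; rewrite lee_fin ler_wpM2l//; exact/lefP/nd_nnsfun_approx.
rewrite lims// lims//; congr (limn _); apply/funext => n.
rewrite !nnsfun_integral//; by apply: eq_bigr => r _; rewrite H.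
Qed.

End weighted_transfer.

(** * Gaussian exponential moments *)

Section normal_law.
Context d (O : measurableType d) (R : realType) (P : probability O R).
Local Notation mu := (@lebesgue_measure R).

(* Only the finiteness of this constant matters: the L^2 bounds hold up to a
   constant factor, and the exact law comes from the moment generating function. *)
Definition normal_second_moment : \bar R := (\int[mu]_x (normal_pdf 0 1 x * x ^+ 2)%:E)%E.

(** Completing the square: the exponential tilt moves the mean to c s^2. *)
Lemma normal_pdf_mgf (c s x : R) : s != 0 ->
  normal_pdf 0 s x * expR (c * x) = expR (c ^+ 2 * s ^+ 2 / 2) * normal_pdf (c * s ^+ 2) s x.
Proof.
move=> s0; rewrite /normal_pdf (negbTE s0) -[LHS]mulrA [RHS]mulrCA; congr (_ * _).
rewrite /normal_fun -!expRD; congr expR.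
by field.
Qed.

Lemma integral_normal_pdf_mgf (c s : R) : s != 0 ->
  (\int[mu]_x (normal_pdf 0 s x * expR (c * x))%:E = (expR (c ^+ 2 * s ^+ 2 / 2))%:E)%E.
Proof.
move=> s0; under eq_integral do rewrite normal_pdf_mgf// EFinM.
rewrite ge0_integralZl//.
- by rewrite integral_normal_pdf mule1.
- by apply/measurable_EFinP; exact: measurable_normal_pdf.
- by move=> x _; rewrite lee_fin normal_pdf_ge0.
Qed.

(** For x >= 0 one has x^2 / 4 <= (1 + x / 2)^2 <= e^x, whence the factor 4. It reduces finiteness
    of the second moment to the moment generating function at 1 and -1. *)
Lemma sqr_le_expR (x : R) : x ^+ 2 <= 4 * (expR x + expR (- x)).
Proof.
wlog x0 : x / 0 <= x => [H|].
  have [/H//|/ltW x0] := leP 0 x.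
  by have := H (- x); rewrite oppr_ge0 sqrrN opprK addrC; exact.
have h := expR_ge1Dx (x / 2).
have e : expR x = expR (x / 2) ^+ 2 by rewrite -expRM_natl; congr expR; field.
have := expR_ge0 (- x); have : (1 + x / 2) ^+ 2 <= expR (x / 2) ^+ 2.
  by rewrite ler_sqr// ?nnegrE ?expR_ge0// addr_ge0// divr_ge0.
by rewrite -e; nra.
Qed.

Lemma measurable_normal_pdf_sqr s :
  measurable_fun setT (fun x : R => (normal_pdf 0 s x * x ^+ 2)%:E).
Proof.
apply/measurable_EFinP; apply: measurable_funM; first exact: measurable_normal_pdf.
exact: (measurable_funX 2 (@measurable_id _ _ setT)).
Qed.

Lemma normal_second_moment_fin_num : normal_second_moment \is a fin_num.
Proof.
have mp := @measurable_normal_pdf R 0 1.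
have me (c : R) : measurable_fun setT (fun x : R => normal_pdf 0 1 x * expR (c * x)).
  by apply: measurable_funM => //; apply: measurableT_comp => //; exact: mulrl_measurable.
have mE (c : R) : measurable_fun setT (fun x : R => (normal_pdf 0 1 x * expR (c * x))%:E).
  by apply/measurable_EFinP.
rewrite ge0_fin_numE; last first.
  by apply: integral_ge0 => x _; rewrite lee_fin mulr_ge0 ?normal_pdf_ge0 ?sqr_ge0.
apply: (@le_lt_trans _ _ (\int[mu]_x (4%:E * ((normal_pdf 0 1 x * expR (1 * x))%:E +
    (normal_pdf 0 1 x * expR (-1 * x))%:E)))%E).
  apply: ge0_le_integral => //.
  - by move=> x _; rewrite lee_fin mulr_ge0 ?normal_pdf_ge0 ?sqr_ge0.
  - exact: measurable_normal_pdf_sqr.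
  - by apply: emeasurable_funM; [exact: measurable_cst|apply: emeasurable_funD; exact: mE].
  - move=> x _; rewrite -EFinD -EFinM lee_fin -mulrDr [leRHS]mulrCA ler_wpM2l ?normal_pdf_ge0//.
    by rewrite mul1r mulN1r; exact: sqr_le_expR.
rewrite ge0_integralZl//; last 2 first.
- by apply: emeasurable_funD; exact: mE.
- by move=> x _; rewrite -EFinD lee_fin addr_ge0// mulr_ge0 ?normal_pdf_ge0 ?expR_ge0.
rewrite ge0_integralD//; try exact: mE.
- by rewrite !integral_normal_pdf_mgf ?oner_neq0// -EFinD -EFinM ltry.
- by move=> x _; rewrite lee_fin mulr_ge0 ?normal_pdf_ge0 ?expR_ge0.
- by move=> x _; rewrite lee_fin mulr_ge0 ?normal_pdf_ge0 ?expR_ge0.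
Qed.

Lemma integral_normal_pdf_sqr (s : R) : 0 < s ->
  (\int[mu]_x (normal_pdf 0 s x * x ^+ 2)%:E = (s ^+ 2)%:E * normal_second_moment)%E.
Proof.
move=> s0; have s0' : s != 0 by rewrite gt_eqF.
rewrite (ge0_integral_scale s0)//; last 2 first.
- exact: measurable_normal_pdf_sqr.
- by move=> x _; rewrite lee_fin mulr_ge0 ?normal_pdf_ge0 ?sqr_ge0.
have m2 : measurable_fun setT (fun x : R => (normal_pdf 0 s (s * x) * (s * x) ^+ 2)%:E).
  apply/measurable_EFinP; apply: measurable_funM.
    apply: (@measurableT_comp _ _ _ _ _ _ (normal_pdf 0 s) setT (fun x => s * x)).
      exact: measurable_normal_pdf.
    exact: mulrl_measurable.
  by apply: measurable_funX; exact: mulrl_measurable.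
rewrite preimage_setT -ge0_integralZl//; first last.
- by rewrite lee_fin ltW.
- by move=> x _; rewrite lee_fin mulr_ge0 ?normal_pdf_ge0 ?sqr_ge0.
rewrite /normal_second_moment -ge0_integralZl//; first last.
- by rewrite lee_fin sqr_ge0.
- by move=> x _; rewrite lee_fin mulr_ge0 ?normal_pdf_ge0 ?sqr_ge0.
- exact: measurable_normal_pdf_sqr.
apply: eq_integral => x _; rewrite -!EFinM; congr EFin.
rewrite /normal_pdf oner_eq0 (negbTE s0').
rewrite /normal_peak /normal_fun.
have -> : - (s * x - 0) ^+ 2 / (s ^+ 2 *+ 2) = - (x - 0) ^+ 2 / (1 ^+ 2 *+ 2) by field.
have -> : Num.sqrt (s ^+ 2 * pi *+ 2) = s * Num.sqrt (1 ^+ 2 * pi *+ 2) :> R.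
  by rewrite -mulrnAr sqrtrM ?sqr_ge0// sqrtr_sqr gtr0_norm// expr1n mul1r.
rewrite invfM !mulrA divff// mul1r; ring.
Qed.

Context (X : O -> R) (mX : measurable_fun setT X) (s : R) (s0 : 0 < s).
Hypothesis lawX : forall A : set R, measurable A -> P [set w | A (X w)] = normal_prob 0 s A.

Lemma normal_law_integral (g : R -> R) : measurable_fun setT g -> (forall x, 0 <= g x) ->
  (\int[P]_w (g (X w))%:E = \int[mu]_x (normal_pdf 0 s x * g x)%:E)%E.
Proof.
move=> mg g0.
have := @weighted_transfer _ _ _ (measurableTypeR R) O (measurableTypeR R) R P mu X id (cst 1) (normal_pdf 0 s) mX _ _ _ _ _ _ g mg g0.
rewrite /= => <- //.
- by apply: eq_integral => w _; rewrite mul1r.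
- exact: measurable_normal_pdf.
- by move=> x; exact: normal_pdf_ge0.
- move=> A mA; under eq_integral do rewrite mul1r.
  rewrite (_ : (fun w => _) = fun w => (\1_(X @^-1` A) w)%:E)//.
  have mXA : measurable (X @^-1` A) by rewrite -[X in measurable X]setTI; exact: mX.
  rewrite integral_indic//.
  transitivity (normal_prob 0 s A); first by rewrite setIT; exact: lawX.
  rewrite /normal_prob integral_mkcond.
  apply: eq_integral => x _; rewrite /patch indicE; case: ifPn => _; first by rewrite mulr1.
  by rewrite mulr0.
Qed.

Lemma normal_law_mgf c : (\int[P]_w (expR (c * X w))%:E = (expR (c ^+ 2 * s ^+ 2 / 2))%:E)%E.
Proof.
rewrite (@normal_law_integral (fun x => expR (c * x)))//; first by rewrite integral_normal_pdf_mgf ?gt_eqF.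
by apply: measurableT_comp => //; exact: mulrl_measurable.
Qed.

Lemma normal_law_sqr : (\int[P]_w (X w ^+ 2)%:E = (s ^+ 2)%:E * normal_second_moment)%E.
Proof.
rewrite (@normal_law_integral (fun x => x ^+ 2))//; first exact: integral_normal_pdf_sqr.
by move=> x; exact: sqr_ge0.
Qed.

End normal_law.

(** * Expectation of a product of independent factors *)

Section independent_product.
Context d (O : measurableType d) (R : realType) (P : probability O R).
Context (N : nat) (X : nat -> O -> R) (mX : forall i, measurable_fun setT (X i)).
Hypothesis indX : forall A : nat -> set R, (forall i, measurable (A i)) ->
  P [set w | forall i, (i < N)%N -> A i (X i w)] = (\prod_(i < N) P [set w | A i (X i w)])%E.
Context (g : nat -> R -> R) (mg : forall i, measurable_fun setT (g i)).
Hypothesis g0 : forall i x, 0 <= g i x.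
Context (m : nat -> R) (gm : forall i, (\int[P]_w (g i (X i w))%:E = (m i)%:E)%E).

(** Interpolates between indicators (k = 0), where the independence hypothesis applies, and the
    functions g (k = N). *)
Let mixed k (A : nat -> set R) i x : R := if (i < k)%N then g i x else \1_(A i) x.
Let mixed_mean k (A : nat -> set R) i : R :=
  if (i < k)%N then m i else fine (P [set w | A i (X i w)]).

Let mixed_ge0 k A i x : 0 <= mixed k A i x.
Proof. by rewrite /mixed; case: ifP. Qed.

Let mXA i (A : set R) : measurable A -> measurable [set w | A (X i w)].
Proof. by move=> mA; rewrite -[X in measurable X]setTI; exact: mX. Qed.

Let measurable_mixed k A i : measurable (A i) -> measurable_fun setT (fun w => mixed k A i (X i w)).
Proof.
rewrite /mixed => mA; have [_|_] := ltnP i k; first exact: (measurableT_comp (mg i) (mX i)).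
exact: (measurableT_comp (measurable_indic mA) (mX i)).
Qed.

Let mean_ge0 i : 0 <= m i.
Proof. by rewrite -lee_fin -gm; apply: integral_ge0 => w _; rewrite lee_fin. Qed.

Let mixed_mean_ge0 k A i : 0 <= mixed_mean k A i.
Proof. by rewrite /mixed_mean; case: ifP => _ //; rewrite fine_ge0. Qed.

(** The step from k to k + 1 replaces the indicator of coordinate k by g k. For every set B put at
    coordinate k, the induction hypothesis is an equality of laws of X k, weighted by the other
    factors on one side and by the product of their means on the other; [weighted_transfer] extends
    it to g k. *)
Let mixed_integral k (A : nat -> set R) : (k <= N)%N -> (forall i, measurable (A i)) ->
  (\int[P]_w (\prod_(i < N) mixed k A i (X i w))%:E = (\prod_(i < N) mixed_mean k A i)%:E)%E.
Proof.
elim: k A => [|k IH] A kN mA.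
  pose B := [set w | forall i, (i < N)%N -> A i (X i w)].
  transitivity (P B).
    have mS : measurable B.
      by apply: measurable_forall_count => i; apply: measurable_impl; exact: mXA.
    have := integral_indic P measurableT mS; rewrite setIT => <-.
    apply: eq_integral => w _; congr EFin; rewrite indicE.
    have [/set_mem H|H] := boolP (w \in B).
      rewrite big1// => i _; rewrite /mixed/= indicE mem_set//; exact: H.
    have [i iN Ai] : exists2 i, (i < N)%N & ~ A i (X i w).
      move: H; rewrite notin_setE/= => /existsNP[i /not_implyP[iN Ai]]; by exists i.
    by rewrite (bigD1 (Ordinal iN))//= /mixed/= indicE memNset// mul0r.
  rewrite indX//= -prodEFin; apply: eq_bigr => i _.
  by rewrite /mixed_mean/= fineK// fin_num_measure//; exact: mXA.
pose k' := Ordinal kN.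
pose y w := \prod_(i < N | i != k') mixed k.+1 A i (X i w).
pose K := \prod_(i < N | i != k') mixed_mean k.+1 A i.
pose A' (B : set R) i := if i == k then B else A i.
have my : measurable_fun setT y.
  rewrite /y; under eq_fun do rewrite -big_filter.
  by apply: measurable_prod => i _; exact: measurable_mixed.
have K0 : 0 <= K by apply: prodr_ge0 => i _.
have ltSk (i : 'I_N) : i != k' -> (i < k.+1)%N = (i < k)%N.
  move=> ik; rewrite ltnS leq_eqVlt (_ : (_ == _ :> nat) = false)//.
  by apply/negbTE; move: ik; apply: contra => /eqP ik; apply/eqP/val_inj.
have nk (i : 'I_N) : i != k' -> (val i == k) = false.
  by move=> ik; apply/negbTE; move: ik; apply: contra => /eqP ik; apply/eqP/val_inj.
have key (B : set R) : measurable B ->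
    (\int[P]_w (y w * \1_B (X k w))%:E = \int[P]_w (cst K w * \1_B (X k w))%:E)%E.
  move=> mB.
  have mA' i : measurable (A' B i) by rewrite /A'; case: ifP.
  transitivity (\int[P]_w (\prod_(i < N) mixed k (A' B) i (X i w))%:E)%E.
    apply: eq_integral => w _; congr EFin.
    rewrite (bigD1 k')//= mulrC {1}/mixed ltnn /A' eqxx; congr (_ * _).
    by apply: eq_bigr => i ik; rewrite /mixed ltSk// /A' nk.
  rewrite IH//; last exact: ltnW.
  transitivity (K%:E * \int[P]_w (\1_B (X k w))%:E)%E; last first.
    rewrite -ge0_integralZl//.
    by apply/measurable_EFinP; exact: (measurableT_comp (measurable_indic mB) (mX k)).
  rewrite (_ : \int[P]_w (\1_B (X k w))%:E = P [set w | B (X k w)])%E; last first.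
    have := integral_indic P measurableT (mXA k mB); rewrite setIT => <-.
    by apply: eq_integral => w _; rewrite !indicE.
  rewrite (bigD1 k')//= mulrC EFinM {2}/mixed_mean ltnn /A' eqxx fineK; last first.
    by rewrite fin_num_measure//; exact: mXA.
  congr (_%:E * _)%E.
  by apply: eq_bigr => i ik; rewrite /mixed_mean ltSk// /A' nk.
have := @weighted_transfer _ _ _ R O O R P P (X k) (X k) y (cst K) (mX k) (mX k) my
  (measurable_cst _) _ _ key (g k) (mg k) (g0 k).
have y0 w : 0 <= y w by apply: prodr_ge0 => i _.
move=> /(_ y0 (fun=> K0)) E.
transitivity (\int[P]_w (y w * g k (X k w))%:E)%E.
  apply: eq_integral => w _; congr EFin.
  by rewrite (bigD1 k')//= mulrC; congr (_ * _); rewrite /mixed ltnSn.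
rewrite E; transitivity (K%:E * \int[P]_w (g k (X k w))%:E)%E.
  rewrite -ge0_integralZl//.
  - by apply/measurable_EFinP; exact: (measurableT_comp (mg k) (mX k)).
  - by move=> w _; rewrite lee_fin.
by rewrite gm -EFinM (bigD1 k')//= mulrC; congr (_ * _)%:E; rewrite /mixed_mean ltnSn.
Qed.

Lemma integral_prod_independent :
  (\int[P]_w (\prod_(i < N) g i (X i w))%:E = (\prod_(i < N) m i)%:E)%E.
Proof.
have := @mixed_integral N (fun=> setT) (leqnn N) (fun=> measurableT).
have E (i : 'I_N) : (i < N)%N by [].
under eq_integral do under eq_bigr do rewrite /mixed E.
by under [in RHS]eq_bigr do rewrite /mixed_mean E.
Qed.

End independent_product.

(** * Moments of Brownian motion and of its increments *)

Section brownian_moments.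
Context (R : realType) d (O : measurableType d) (P : probability O R).
Context (W : R -> {RV P >-> R}) (bm : brownian_motion W).
Implicit Types (s t c : R).

Let mW t : measurable_fun setT (W t). Proof. exact: measurable_funPT. Qed.

Let mincr s t : measurable_fun setT (fun w => W t w - W s w).
Proof. exact: measurable_funB. Qed.

(** The case s = t, outside the scope of [bm_increment], is included because consecutive Karandikar
    times coincide once the horizon is reached. *)
Lemma brownian_increment_mgf s t c : 0 <= s <= t ->
  (\int[P]_w (expR (c * (W t w - W s w)))%:E = (expR (c ^+ 2 * (t - s) / 2))%:E)%E.
Proof.
move=> /andP[s0]; rewrite le_eqVlt => /predU1P[->|st].
  under eq_integral do rewrite subrr mulr0 expR0.
  by rewrite subrr mulr0 mul0r expR0 integral_cst//=; have /= -> := probability_setT P; rewrite mule1.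
have ts0 : 0 < Num.sqrt (t - s) by rewrite sqrtr_gt0 subr_gt0.
rewrite (normal_law_mgf (mincr s t) ts0); first by rewrite sqr_sqrtr// ltW// subr_gt0.
by move=> A mA; rewrite (bm_increment bm).
Qed.

Definition brownian_variance : R := fine (@normal_second_moment R).

Lemma brownian_variance_ge0 : 0 <= brownian_variance.
Proof.
rewrite fine_ge0// integral_ge0// => x _.
by rewrite lee_fin mulr_ge0 ?normal_pdf_ge0 ?sqr_ge0.
Qed.

Lemma brownian_increment_sqr s t : 0 <= s <= t ->
  (\int[P]_w ((W t w - W s w) ^+ 2)%:E = ((t - s) * brownian_variance)%:E)%E.
Proof.
move=> /andP[s0]; rewrite le_eqVlt => /predU1P[->|st].
  under eq_integral do rewrite subrr expr0n.
  by rewrite subrr mul0r integral0.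
have ts0 : 0 < Num.sqrt (t - s) by rewrite sqrtr_gt0 subr_gt0.
rewrite (normal_law_sqr (mincr s t) ts0).
  by rewrite sqr_sqrtr ?ltW ?subr_gt0// EFinM fineK// normal_second_moment_fin_num.
by move=> A mA; rewrite (bm_increment bm).
Qed.

Lemma brownian_sqr t : 0 <= t -> (\int[P]_w (W t w ^+ 2)%:E = (t * brownian_variance)%:E)%E.
Proof.
move=> t0; have := @brownian_increment_sqr 0 t; rewrite lexx t0 subr0 => <- //.
by apply: eq_integral => w _; rewrite (bm_start bm) subr0.
Qed.

Let integrable_sqr t : 0 <= t -> P.-integrable setT (fun w => (W t w ^+ 2)%:E).
Proof.
move=> t0; apply/integrableP; split; first by apply/measurable_EFinP; exact: measurable_funX.
under eq_integral do rewrite gee0_abs ?lee_fin ?sqr_ge0//.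
by rewrite brownian_sqr// ltry.
Qed.

Lemma integrable_brownian_mul s t : 0 <= s -> 0 <= t ->
  P.-integrable setT (fun w => (W s w * W t w)%:E).
Proof.
move=> s0 t0; apply: (le_integrable measurableT _ _ (integrableD measurableT (integrable_sqr s0) (integrable_sqr t0))).
  by apply/measurable_EFinP; exact: measurable_funM.
move=> w _ /=; rewrite lee_fin normrM [leRHS]ger0_norm ?addr_ge0 ?sqr_ge0//.
rewrite -(real_normK (num_real (W s w))) -(real_normK (num_real (W t w))).
by have := sqr_ge0 (`|W s w| - `|W t w|); nra.
Qed.

(** Polarisation: 2 W_s W_t = W_t^2 + W_s^2 - (W_t - W_s)^2, with all three expectations known. *)
Lemma brownian_covariance s t : 0 <= s -> 0 <= t ->
  (\int[P]_w (W s w * W t w)%:E = (Num.min s t * brownian_variance)%:E)%E.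
Proof.
wlog st : s t / s <= t => [H s0 t0|].
  have [st|/ltW ts] := leP s t; first by have := H s t st s0 t0; rewrite min_l.
  have := H t s ts t0 s0; rewrite min_l// => <-.
  by apply: eq_integral => w _; rewrite mulrC.
move=> s0 t0; rewrite min_l//.
have E : (\int[P]_w ((W t w - W s w) ^+ 2)%:E = \int[P]_w (W t w ^+ 2)%:E + \int[P]_w (W s w ^+ 2)%:E
    - 2%:E * \int[P]_w (W s w * W t w)%:E)%E.
  rewrite -integralD//; try exact: integrable_sqr.
  rewrite -integralZl//; last exact: integrable_brownian_mul.
  rewrite -integralB//.
  - by apply: eq_integral => w _; congr EFin => /=; ring.
  - by apply: integrableD => //; exact: integrable_sqr.
  - by apply: integrableZl => //; exact: integrable_brownian_mul.
move: E; rewrite !brownian_sqr// brownian_increment_sqr ?s0//.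
have : (\int[P]_w (W s w * W t w)%:E)%E \is a fin_num.
  by apply: integrable_fin_num => //; exact: integrable_brownian_mul.
case: (\int[P]_w (W s w * W t w)%:E)%E => //= x _ [] E; congr EFin.
by move: E; rewrite !mulrBl; lra.
Qed.

(** Independent increments factor the exponential. The parameter a is kept because a = 1 gives the
    moment itself and a = 2 the second moment that controls truncation. *)
Lemma brownian_sum_mgf (t c : nat -> R) (a : R) N : 0 <= t 0%N ->
  {homo t : i j / (i <= j)%N >-> i <= j} ->
  (\int[P]_w (expR (a * \sum_(i < N) c i * (W (t i.+1) w - W (t i) w)))%:E =
   (expR (a ^+ 2 * (\sum_(i < N) c i ^+ 2 * (t i.+1 - t i)) / 2))%:E)%E.
Proof.
move=> t0 tm.
have ti i : 0 <= t i by rewrite (le_trans t0)// tm.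
have := @integral_prod_independent _ O R P N (fun i w => W (t i.+1) w - W (t i) w)
  (fun i => mincr (t i) (t i.+1)) _ (fun i x => expR (a * c i * x)) _ _
  (fun i => expR ((a * c i) ^+ 2 * (t i.+1 - t i) / 2)).
move=> /(_ _ _ _ _)/wrap[].
- by move=> A mA; exact: (bm_independent bm).
- by move=> i; apply: measurableT_comp => //; exact: mulrl_measurable.
- by move=> i x; exact: expR_ge0.
- by move=> i; apply: brownian_increment_mgf; rewrite ti tm.
move=> E; transitivity (\int[P]_w (\prod_(i < N) expR (a * c i * (W (t i.+1) w - W (t i) w)))%:E)%E.
  apply: eq_integral => w _; rewrite -expR_sum; congr (expR _)%:E.
  by rewrite mulr_sumr; apply: eq_bigr => i _; rewrite mulrA.
rewrite E -expR_sum; congr (expR _)%:E.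
rewrite mulr_sumr mulr_suml; apply: eq_bigr => i _; ring.
Qed.

End brownian_moments.

Lemma integral_sqr_sum d (T : measurableType d) (R : realType) (mu : {measure set T -> \bar R})
    (D : set T) n (c : 'I_n -> R) (u : 'I_n -> T -> R) (K : 'I_n -> 'I_n -> R) : measurable D ->
  (forall i j, mu.-integrable D (fun x => (u i x * u j x)%:E)) ->
  (forall i j, \int[mu]_(x in D) (u i x * u j x)%:E = (K i j)%:E)%E ->
  (\int[mu]_(x in D) ((\sum_i c i * u i x) ^+ 2)%:E = (\sum_i \sum_j c i * c j * K i j)%:E)%E.
Proof.
move=> mD iu uK.
transitivity (\int[mu]_(x in D) \sum_i (\sum_j (c i * c j)%:E * (u i x * u j x)%:E))%E.
  apply: eq_integral => x _.
  rewrite expr2 big_distrlr/= -sumEFin; apply: eq_bigr => i _.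
  rewrite -sumEFin; apply: eq_bigr => j _.
  by rewrite -EFinM; congr EFin; ring.
rewrite integral_sum//; last first.
  move=> i; apply: integrable_sum => // j _; exact: integrableZl.
rewrite -sumEFin; apply: eq_bigr => i _.
rewrite integral_sum//; last by move=> j; exact: integrableZl.
rewrite -sumEFin; apply: eq_bigr => j _.
by rewrite integralZl// uK -EFinM.
Qed.

(** * Isometry for finite sums *)

Section isometry.
Context (R : realType).
Implicit Types (F : (R -> R) -> R) (f : R -> R) (M : R).
Local Notation mu := (@lebesgue_measure R).

(** F acts on arbitrary functions, so the same F can be evaluated on Brownian paths and on the
    deterministic paths t |-> 1_{x < t}. *)
Definition finite_combination M F := exists L : seq (R * R),
  (forall p, p \in L -> 0 <= p.2 <= M) /\ forall z, F z = \sum_(p <- L) p.1 * z p.2.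

Lemma finite_combinationD M F G : finite_combination M F -> finite_combination M G ->
  finite_combination M (fun z => F z + G z).
Proof.
move=> [L [HL FL]] [L' [HL' GL]]; exists (L ++ L'); split.
  by move=> p; rewrite mem_cat => /orP[/HL|/HL'].
by move=> z; rewrite FL GL big_cat.
Qed.

Lemma finite_combinationZ M a F : finite_combination M F ->
  finite_combination M (fun z => a * F z).
Proof.
move=> [L [HL FL]]; exists [seq (a * p.1, p.2) | p <- L]; split.
  by move=> p /mapP[q qL ->] /=; exact: HL.
by move=> z; rewrite FL big_map mulr_sumr; apply: eq_bigr => p _; rewrite mulrA.
Qed.

Lemma finite_combinationB M F G : finite_combination M F -> finite_combination M G ->
  finite_combination M (fun z => F z - G z).
Proof.
move=> hF /(finite_combinationZ (-1)) hG.
have [L [HL E]] := finite_combinationD hF hG; exists L; split => // z.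
by rewrite -E mulN1r.
Qed.

Lemma finite_combination_eval M t : 0 <= t <= M -> finite_combination M (fun z => z t).
Proof.
move=> tM; exists [:: (1, t)]; split; first by move=> p; rewrite inE => /eqP ->.
by move=> z; rewrite big_seq1/= mul1r.
Qed.

Lemma finite_combination_karandikar f n M N : 0 <= M ->
  finite_combination M (fun z => karandikar_partial f z n M N).
Proof.
move=> M0; elim: N => [|N [L [HL E]]].
  by exists [::]; split => // z; rewrite /karandikar_partial big_ord0 big_nil.
have tb i := karandikar_time_bounds f n i M0.
have [L' [HL' E']] := finite_combinationZ (f (karandikar_time f n M N))
  (finite_combinationB (finite_combination_eval (tb N.+1)) (finite_combination_eval (tb N))).
exists (L ++ L'); split; first by move=> p; rewrite mem_cat => /orP[/HL|/HL'].
by move=> z; rewrite karandikar_partialS E E' big_cat.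
Qed.

Lemma integral_indic_lt_mul M s t : 0 <= s <= M -> 0 <= t <= M ->
  mu.-integrable `[0, M[ (fun x => ((x < s)%R%:R * (x < t)%R%:R : R)%:E) /\
  (\int[mu]_(x in `[0%R, M[) ((x < s)%R%:R * (x < t)%R%:R)%:E = (Num.min s t)%:E)%E.
Proof.
move=> /andP[s0 sM] /andP[t0 tM]; set m := Num.min s t.
have m0 : 0 <= m by rewrite le_min s0.
have mM : m <= M by rewrite ge_min sM.
have E x : x \in `[0, M[%classic -> ((x < s)%R%:R * (x < t)%R%:R : R)%:E = (\1_`[0, m[ x)%:E.
  rewrite inE/= in_itv/= => /andP[x0 _]; rewrite indicE mem_setE in_itv/= x0/= lt_min.
  by case: (x < s)%R; case: (x < t)%R; rewrite ?mulr0 ?mul0r ?mulr1.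
have mi : mu.-integrable `[0, M[ (fun x => (\1_`[0, m[ x : R)%:E).
  apply: measurable_bounded_integrable => //.
  - by rewrite /= lebesgue_measure_itv/=; case: ifP => // _; rewrite -EFinB ltry.
  - by exists 1; split => // r r1 x _ /=; rewrite (le_trans _ (ltW r1))// ger0_norm// indicE lern1 leq_b1.
split.
  by apply: eq_integrable mi => // x xM; rewrite -E.
transitivity (\int[mu]_(x in `[0%R, M[) (\1_(`[0%R, m[%classic : set R) x)%:E)%E; first exact: eq_integral.
rewrite integral_indic// (_ : _ `&` _ = `[0, m[%classic); last first.
  apply/setIidPl => x /=; rewrite !in_itv/= => /andP[->/= xm]; exact: lt_le_trans mM.
rewrite /= lebesgue_measure_itv/= lte_fin.
by move: m0; rewrite le_eqVlt => /predU1P[<-|->]; rewrite ?ltxx// sube0.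
Qed.

Context d (O : measurableType d) (P : probability O R).
Context (W : R -> {RV P >-> R}) (bm : brownian_motion W).

(* Both sides are quadratic forms in the coefficients of [F]: the variance of
   [F W] and the L^2 norm of [F] applied to the paths [t |-> 1_{x < t}] agree
   because E[W_s W_t] is proportional to min s t = int 1_{x < s} 1_{x < t} dx. *)
Lemma brownian_isometry M F : finite_combination M F ->
  (\int[P]_w (F (fun t => W t w) ^+ 2)%:E =
   (brownian_variance R)%:E * \int[mu]_(x in `[0%R, M[) (F (fun t => (x < t)%R%:R) ^+ 2)%:E)%E.
Proof.
move=> [L [HL FL]].
pose c i := (tnth (in_tuple L) i).1; pose t i := (tnth (in_tuple L) i).2.
have tM i : 0 <= t i <= M by apply: HL; exact: mem_tnth.
have E z : F z = \sum_i c i * z (t i) by rewrite FL big_tnth.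
under eq_integral do rewrite E.
under [in RHS]eq_integral do rewrite E.
rewrite (@integral_sqr_sum _ O R P setT _ c (fun i w => W (t i) w)
  (fun i j => Num.min (t i) (t j) * brownian_variance R))//; last 2 first.
- by move=> i j; apply: integrable_brownian_mul => //; have /andP[] := tM i; have /andP[] := tM j.
- by move=> i j; apply: brownian_covariance => //; have /andP[] := tM i; have /andP[] := tM j.
rewrite (@integral_sqr_sum _ _ R mu `[0%R, M[%classic _ c (fun i x => (x < t i)%R%:R)
  (fun i j => Num.min (t i) (t j)))//; last 2 first.
- by move=> i j; have [] := integral_indic_lt_mul (tM i) (tM j).
- by move=> i j; have [] := integral_indic_lt_mul (tM i) (tM j).
rewrite -EFinM; congr EFin; rewrite mulr_sumr; apply: eq_bigr => i _.
by rewrite mulr_sumr; apply: eq_bigr => j _; rewrite mulrA mulrC.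
Qed.

(** Along the path t |-> 1_{x < t} only the interval [tau_i, tau_{i+1}[ containing x has a nonzero
    increment, equal to 1. The sum thus picks the value at tau_i, and f x is within 2^-n of f tau_i
    because f has not yet moved by 2^-n. *)
Lemma karandikar_step f n M N x : continuous f -> 0 <= x < M ->
  karandikar_time f n M N = M ->
  exists i, [/\ 0 <= karandikar_time f n M i <= M,
    `|f x - f (karandikar_time f n M i)| < 2^-1 ^+ n &
    forall h : R -> R, \sum_(j < N) h (karandikar_time f n M j) *
     ((x < karandikar_time f n M j.+1)%R%:R - (x < karandikar_time f n M j)%R%:R) =
     h (karandikar_time f n M i)].
Proof.
move=> cf xM NM; have M0 : 0 <= M by have /andP[x0 /ltW] := xM; exact: le_trans.
have [i iN /andP[ix xi]] := karandikar_time_cover M0 NM xM.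
exists i; split; first exact: karandikar_time_bounds.
  apply: (@inf_hitting_lt _ f n _ M); first by rewrite ix -karandikar_timeS.
  by have /andP[] := karandikar_time_bounds f n i M0.
move=> h; rewrite (bigD1 (Ordinal iN))//= xi ltNge ix/= subr0 mulr1 big1 ?addr0// => j ji.
have {}ji : (val j != i)%N by apply: contra ji => /eqP ji; apply/eqP/val_inj.
have hm := karandikar_time_homo f n M0.
move: ji; rewrite neq_ltn => /orP[ji|ij].
  rewrite [x < karandikar_time _ _ _ j]ltNge [x < karandikar_time _ _ _ j.+1]ltNge.
  by rewrite (le_trans (hm _ _ ji) ix) (le_trans (hm _ _ (ltnW ji)) ix) subrr mulr0.
rewrite (lt_le_trans xi (hm _ _ ij)) (lt_le_trans xi (hm _ _ (leqW ij))).
by rewrite subrr mulr0.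
Qed.

End isometry.

(** * Exponential moment of an almost sure limit *)

Section exponential_limit.
Context d (O : measurableType d) (R : realType) (P : probability O R).
Context (S : nat -> O -> R) (mS : forall n, measurable_fun setT (S n)).
Context (C : R) (C0 : 0 <= C).
Hypothesis SC : forall n,
  (\int[P]_w ((S n.+1 w - S n w) ^+ 2)%:E <= (C * 2^-1 ^+ n ^+ 2)%:E)%E.

Let h n : R := 2^-1 ^+ n.
Let h0 n : 0 < h n. Proof. by rewrite exprn_gt0. Qed.

Let increment n w := `|S n.+1 w - S n w|.

Let mincrement n : measurable_fun setT (increment n).
Proof. by apply: measurableT_comp => //; exact: measurable_funB. Qed.

(* AM-GM: [|D| <= (D^2 / h + h) / 2] with h = 2^-n *)
Let increment_integral n : (\int[P]_w (increment n w)%:E <= ((C + 1) * h n)%:E)%E.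
Proof.
apply: (@le_trans _ _ (\int[P]_w ((h n)^-1%:E * ((S n.+1 w - S n w) ^+ 2)%:E + (h n)%:E))%E).
  apply: ge0_le_integral => //.
  - by move=> w _; rewrite lee_fin /increment.
  - exact/measurable_EFinP.
  - apply: emeasurable_funD => //; apply: emeasurable_funM => //.
    by apply/measurable_EFinP; apply: measurable_funX; exact: measurable_funB.
  - move=> w _; rewrite -EFinM -EFinD lee_fin /increment -(real_normK (num_real (_ - _))).
    set x := `| _ |; have x0 : 0 <= x by exact: normr_ge0.
    rewrite mulrC -(ler_pM2r (h0 n)) mulrDl divfK ?gt_eqF// ?h0//.
    by have := sqr_ge0 (x - h n); have := h0 n; nra.
rewrite ge0_integralD//; last 3 first.
- by move=> w _; rewrite -EFinM lee_fin mulr_ge0 ?sqr_ge0// invr_ge0 ltW.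
- apply: emeasurable_funM => //.
  by apply/measurable_EFinP; apply: measurable_funX; exact: measurable_funB.
- by move=> w _; rewrite lee_fin ltW.
rewrite integral_cst//= ge0_integralZl//; last 3 first.
- by apply/measurable_EFinP; apply: measurable_funX; exact: measurable_funB.
- by move=> w _; rewrite lee_fin sqr_ge0.
- by rewrite lee_fin invr_ge0 ltW.
have /= -> := probability_setT P; rewrite mule1 mulrDl mul1r EFinD leeD2r//.
apply: (@le_trans _ _ ((h n)^-1%:E * (C * h n ^+ 2)%:E)%E).
  by rewrite lee_pmul2l ?lte_fin ?invr_gt0//; exact: SC.
rewrite -EFinM lee_fin (_ : (h n)^-1 * _ = C * h n)//.
by field; rewrite gt_eqF.
Qed.

(** The expected sum of the |S (n+1) - S n| is at most the sum of (C + 1) 2^-n, that is 2 (C + 1).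
    So it is almost surely finite, and S is an absolutely convergent telescoping series. *)
Let ae_cvg : {ae P, forall w, cvgn (S ^~ w)}.
Proof.
pose f w := (\sum_(n <oo) (increment n w)%:E)%E.
have If : P.-integrable setT f.
  apply/integrableP; split.
    apply: ge0_emeasurable_sum => [n w _ _|n _]; first by rewrite lee_fin /increment.
    exact/measurable_EFinP.
  rewrite (@eq_integral _ _ _ P setT f); last first.
    by move=> w _; rewrite gee0_abs//; apply: nneseries_ge0 => n _ _; rewrite lee_fin /increment.
  rewrite integral_nneseries; first last.
  - by move=> n w _; rewrite lee_fin /increment.
  - by move=> n; exact/measurable_EFinP.
  - exact: measurableT.
  apply: (@le_lt_trans _ _ (2 * (C + 1))%:E); last by rewrite ltry.
  apply: lime_le.
    apply: is_cvg_nneseries => n _ _; apply: integral_ge0 => w _.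
    by rewrite lee_fin /increment.
  apply: nearW => n.
  apply: (@le_trans _ _ (\sum_(0 <= i < n) ((C + 1) * h i)%:E)%E); first exact: lee_sum.
  rewrite sumEFin lee_fin -mulr_sumr mulrC ler_wpM2r ?addr_ge0//.
  have -> : \sum_(0 <= i < n) h i = 2 - 2 * h n.
    elim: n => [|n IH]; first by rewrite big_nil /h expr0 mulr1 subrr.
    by rewrite big_nat_recr//= IH /h exprS; field.
  by rewrite gerBl mulr_ge0// ltW.
have [N [mN N0 HN]] := integrable_ae measurableT If.
exists N; split => // w /= ncv; apply: HN => /= /(_ Logic.I) fin; apply: ncv.
have cD : cvgn [series `|telescope (S ^~ w) n| ]_n.
  apply: nondecreasing_is_cvgn.
    by apply: nondecreasing_series => n _ _; exact: normr_ge0.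
  exists (fine (f w)) => _ [n _ <-].
  rewrite -lee_fin fineK// /series/= -sumEFin.
  by apply: nneseries_lim_ge => i _ _; rewrite lee_fin.
have /normed_cvg cT := cD.
rewrite (_ : S ^~ w = fun n => S 0%N w + series (telescope (S ^~ w)) n); last first.
  by apply/funext => n; rewrite -(eq_sum_telescope (S ^~ w)).
by apply: is_cvgD => //; exact: is_cvg_cst.
Qed.

Context (v : nat -> R) (V : R) (vV : v n @[n --> \oo] --> V).
Hypothesis Smgf : forall n a, (\int[P]_w (expR (a * S n w))%:E = (expR (a ^+ 2 * v n / 2))%:E)%E.

Let trunc k (x : R) : R := Num.min (expR x) k.+1%:R.

Let trunc_ge0 k x : 0 <= trunc k x.
Proof. by rewrite le_min expR_ge0 ler0n. Qed.

Let mtrunc k (X : O -> R) : measurable_fun setT X -> measurable_fun setT (fun w => trunc k (X w)).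
Proof. by move=> mX; apply: measurable_minr => //; exact: measurableT_comp. Qed.

Let mexp (X : O -> R) : measurable_fun setT X -> measurable_fun setT (fun w => expR (X w)).
Proof. by move=> mX; exact: measurableT_comp. Qed.

Let L w := limn (S ^~ w).

Let mL : measurable_fun setT L. Proof. exact: measurable_limn. Qed.

Let truncint k X : measurable_fun setT X -> (\int[P]_w (trunc k (X w))%:E)%E \is a fin_num.
Proof.
move=> mX; rewrite ge0_fin_numE; last by apply: integral_ge0 => w _; rewrite lee_fin.
apply: (@le_lt_trans _ _ (\int[P]_w (k.+1%:R)%:E)%E).
  apply: ge0_le_integral => //.
  - by move=> w _; rewrite lee_fin.
  - by apply/measurable_EFinP; exact: mtrunc.
  - by move=> w _; rewrite lee_fin ge_min lexx orbT.
by rewrite integral_cst//=; have /= -> := probability_setT P; rewrite mule1 ltry.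
Qed.

Let trunc_cvg k : (\int[P]_w (trunc k (S n w))%:E @[n --> \oo] --> \int[P]_w (trunc k (L w))%:E)%E.
Proof.
have [] := @dominated_convergence _ _ _ P setT measurableT
  (fun n w => (trunc k (S n w))%:E) (fun w => (trunc k (L w))%:E) (fun=> k.+1%:R%:E).
- by move=> n; apply/measurable_EFinP; exact: mtrunc.
- by apply/measurable_EFinP; exact: mtrunc.
- apply: filterS ae_cvg => w cS _; apply: cvg_EFin; first exact: nearW.
  apply: (@continuous_cvg _ _ _ _ _ (S ^~ w) (trunc k)) => //.
  by apply: continuous_min; [exact: continuous_expR|exact: cst_continuous].
- exact: finite_measure_integrable_cst.
- by apply: nearW => w n _; rewrite gee0_abs ?lee_fin// ge_min lexx orbT.
by [].
Qed.

(** With y = exp (S n) and K = k + 1, min (y, K) <= y <= min (y, K) + y^2 / K. The moments of y and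
    y^2 come from [Smgf] at a = 1 and a = 2, and n tends to infinity by [trunc_cvg]. *)
Let trunc_bounds k :
  ((expR (V / 2) - k.+1%:R^-1 * expR (2 * V))%:E <= \int[P]_w (trunc k (L w))%:E <= (expR (V / 2))%:E)%E.
Proof.
have kp : (0 : R) < k.+1%:R by [].
have cE a : expR (a * v n) @[n --> \oo] --> expR (a * V).
  by apply: (@continuous_cvg _ _ _ _ _ (fun n => a * v n) expR); [exact: continuous_expR|apply: cvgM => //; exact: cvg_cst].
have bn n : ((expR (2^-1 * v n) - k.+1%:R^-1 * expR (2 * v n))%:E <= \int[P]_w (trunc k (S n w))%:E <= (expR (2^-1 * v n))%:E)%E.
  have E1 : (\int[P]_w (expR (S n w))%:E = (expR (2^-1 * v n))%:E)%E.
    have := Smgf n 1; rewrite expr1n mul1r mulrC => <-.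
    by apply: eq_integral => w _; rewrite mul1r.
  have E2 : (\int[P]_w (expR (2 * S n w))%:E = (expR (2 * v n))%:E)%E.
    by rewrite Smgf; congr (expR _)%:E; field.
  apply/andP; split; last first.
    rewrite -E1; apply: ge0_le_integral => //.
    - by move=> w _; rewrite lee_fin.
    - by apply/measurable_EFinP; exact: mtrunc.
    - by apply/measurable_EFinP; exact: mexp.
    - by move=> w _; rewrite lee_fin ge_min lexx.
  rewrite EFinB leeBlDr// EFinM -E1 -E2.
  have m2 : measurable_fun setT (fun w => (expR (2 * S n w))%:E).
    by apply/measurable_EFinP; apply: mexp; exact: measurable_funM.
  rewrite -ge0_integralZl//.
  rewrite -ge0_integralD//; last 3 first.
  - by move=> w _; rewrite lee_fin.
  - by apply/measurable_EFinP; exact: mtrunc.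
  - exact: emeasurable_funM.
  apply: ge0_le_integral => //.
  - by apply/measurable_EFinP; exact: mexp.
  - apply: emeasurable_funD; first by apply/measurable_EFinP; exact: mtrunc.
    exact: emeasurable_funM.
  - move=> w _; rewrite -EFinM -EFinD lee_fin /trunc.
    have e2 : expR (2 * S n w) = expR (S n w) ^+ 2 by rewrite expRM_natl.
    have [ek|/ltW ke] := leP (expR (S n w)) k.+1%:R.
      by rewrite lerDl mulr_ge0 ?invr_ge0// expR_ge0.
    rewrite ler_wpDl// e2 mulrC ler_pdivlMr// expr2 ler_wpM2l// expR_ge0//.
rewrite -(fineK (truncint k mL)) !lee_fin.
have cf : fine (\int[P]_w (trunc k (S n w))%:E)%E @[n --> \oo] --> fine (\int[P]_w (trunc k (L w))%:E)%E.
  by apply: fine_cvg; rewrite fineK ?truncint//; exact: trunc_cvg.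
apply/andP; split.
  rewrite (mulrC V).
  apply: (ler_cvg_to _ cf); first by apply: cvgB; [exact: cE|apply: cvgM; [exact: cvg_cst|exact: cE]].
  by apply: nearW => n; rewrite -lee_fin fineK ?truncint//; have /andP[] := bn n.
rewrite (mulrC V); apply: (ler_cvg_to cf (cE _)).
by apply: nearW => n; rewrite -lee_fin fineK ?truncint//; have /andP[] := bn n.
Qed.

(* Passing to the limit under the expectation: [expR] is truncated at level k,
   and the second moments of [expR (S n)] bound the error uniformly in n. *)
Lemma exponential_limit : (\int[P]_w (expR (limn (S ^~ w)))%:E = (expR (V / 2))%:E)%E.
Proof.
have H : (\int[P]_w (trunc k (L w))%:E @[k --> \oo] --> \int[P]_w (expR (L w))%:E)%E.
  rewrite (_ : (fun w => (expR (L w))%:E) = fun w => limn (fun k => (trunc k (L w))%:E)); last first.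
    apply/funext => w; apply/esym/cvg_lim => //; apply: cvg_near_cst.
    exists (Num.truncn (expR (L w))) => // k /= kL; congr EFin; apply/min_idPl.
    by rewrite (le_trans (ltW (truncnS_gt _)))// ler_nat ltnS.
  apply: cvg_monotone_convergence => //.
  - by move=> k; apply/measurable_EFinP; exact: mtrunc.
  - by move=> k w _; rewrite lee_fin.
  - move=> w _ k k' kk'; rewrite lee_fin le_min ge_min lexx/=.
    by rewrite ge_min ler_nat ltnS kk' orbT.
apply: (cvg_unique _ H) => //.
apply: (@squeeze_cvge _ _ _ _ (fun k => (expR (V / 2) - k.+1%:R^-1 * expR (2 * V))%:E) _
  (fun=> (expR (V / 2))%:E)); [exact: nearW| |exact: cvg_cst].
apply: cvg_EFin; first exact: nearW.
have : expR (V / 2) - k.+1%:R^-1 * expR (2 * V) @[k --> \oo] --> expR (V / 2) - 0 * expR (2 * V).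
  by apply: cvgB; [exact: cvg_cst|apply: cvgM; [exact: cvg_harmonic|exact: cvg_cst]].
by rewrite mul0r subr0.
Qed.

End exponential_limit.

(** * Exponential moment of the integral of a deterministic function *)

Section exponential_integral.
Context (R : realType) d (O : measurableType d) (P : probability O R).
Context (W : R -> {RV P >-> R}) (bm : brownian_motion W).
Context (f : R -> R) (M : R) (cf : continuous f) (M0 : 0 <= M).
Local Notation mu := (@lebesgue_measure R).

Let mW t : measurable_fun setT (W t). Proof. exact: measurable_funPT. Qed.
Let tau n i := karandikar_time f n M i.
Let taub n i : 0 <= tau n i <= M. Proof. exact: karandikar_time_bounds. Qed.
(** Karandikar's sum of h along the path t |-> 1_{x < t}; in x it is the step function equal to h
    (tau_j) on [tau_j, tau_{j+1}[. *)
Let step N n (h : R -> R) (x : R) : R :=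
  \sum_(j < N) h (tau n j) * ((x < tau n j.+1)%R%:R - (x < tau n j)%R%:R).

Let IM := `[0%R : R, M[%classic : set R.

Let mIM : measurable IM. Proof. exact: measurable_itv. Qed.

Let muM : mu IM = M%:E.
Proof.
rewrite /IM lebesgue_measure_itv/= lte_fin.
by move: M0; rewrite le_eqVlt => /predU1P[<-|->]; rewrite ?ltxx// sube0.
Qed.

Let ltint (t : R) : 0 <= t <= M -> mu.-integrable IM (fun x : R => ((x < t)%R%:R : R)%:E) /\
  (\int[mu]_(x in IM) ((x < t)%R%:R : R)%:E = t%:E)%E.
Proof.
move=> tM; have [H1 H2] := integral_indic_lt_mul tM tM.
have E (x : R) : ((x < t)%R%:R * (x < t)%R%:R : R)%:E = ((x < t)%R%:R : R)%:E.
  by case: (x < t); rewrite ?mulr0 ?mulr1.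
split; first by apply: eq_integrable H1.
by rewrite minxx in H2; rewrite -H2; apply: eq_integral.
Qed.

Let stepint N n h : mu.-integrable IM (fun x => (step N n h x)%:E) /\
  (\int[mu]_(x in IM) (step N n h x)%:E =
   (\sum_(j < N) h (tau n j) * (tau n j.+1 - tau n j))%:E)%E.
Proof.
have E x : (step N n h x)%:E = (\sum_(j < N) (h (tau n j))%:E *
    (((x < tau n j.+1)%R%:R : R)%:E - ((x < tau n j)%R%:R : R)%:E))%E.
  by rewrite /step -sumEFin; apply: eq_bigr => j _; rewrite -EFinB -EFinM.
have iB (j : nat) : mu.-integrable IM (fun x : R =>
    (((x < tau n j.+1)%R%:R : R)%:E - ((x < tau n j)%R%:R : R)%:E))%E.
  by apply: integrableB => //; [have [] := ltint (taub n j.+1)|have [] := ltint (taub n j)].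
have ij (j : nat) : mu.-integrable IM (fun x : R => (h (tau n j))%:E *
    (((x < tau n j.+1)%R%:R : R)%:E - ((x < tau n j)%R%:R : R)%:E))%E.
  exact: integrableZl.
split.
  rewrite (_ : (fun x => _) = (fun x => \sum_(j < N) (h (tau n j))%:E *
    (((x < tau n j.+1)%R%:R : R)%:E - ((x < tau n j)%R%:R : R)%:E))%E); last exact/funext.
  by apply: integrable_sum.
under eq_integral do rewrite E.
rewrite integral_sum// -sumEFin; apply: eq_bigr => j _.
have [i1 I1] := ltint (taub n j.+1); have [i2 I2] := ltint (taub n j).
rewrite (@integralZl _ _ _ mu IM _ _ (iB j))//.
by rewrite integralB// I1 I2 -EFinB -EFinM.
Qed.

Let fb : exists2 B, 0 <= B & forall x, 0 <= x <= M -> `|f x| <= B.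
Proof.
have [|c _ Hc] := @EVT_max R (fun x => `|f x|) 0 M M0.
  by apply: continuous_subspaceT => x; apply: cvg_norm; exact: cf.
by exists `|f c| => // x xM; apply: Hc; rewrite in_itv.
Qed.

Let step_near n N x : tau n N = M -> x \in IM -> exists i,
  [/\ 0 <= tau n i <= M, `|f x - f (tau n i)| < 2^-1 ^+ n &
    forall h, step N n (h \o f) x = h (f (tau n i))].
Proof.
move=> NM; rewrite inE /IM/= in_itv/= => xM.
have [i [tM fi H]] := karandikar_step cf xM NM.
by exists i; split => // h; rewrite /step (H (h \o f)).
Qed.

Let measurable_step N n h : measurable_fun IM (step N n h).
Proof. by have [/measurable_int/measurable_EFinP] := stepint N n h. Qed.

(** Both step functions are within 2^-n of f, so they differ by at most 2 * 2^-n; the square of this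
    bound is integrated over a length M. *)
Let step_diff_sqr n N N' : tau n N = M -> tau n.+1 N' = M ->
  (\int[mu]_(x in IM) ((step N' n.+1 f x - step N n f x) ^+ 2)%:E <= (4 * M * 2^-1 ^+ n ^+ 2)%:E)%E.
Proof.
move=> NM NM'.
apply: (@le_trans _ _ (\int[mu]_(x in IM) (4 * 2^-1 ^+ n ^+ 2)%:E)%E); last first.
  by rewrite integral_cst// [X in (_ * X)%E]muM -EFinM lee_fin mulrAC.
apply: ge0_le_integral => //.
- by move=> x _; rewrite lee_fin sqr_ge0.
- apply/measurable_EFinP; apply: measurable_funX; apply: measurable_funB; exact: measurable_step.
move=> x xM; rewrite lee_fin.
have [i [_ fi H]] := step_near NM (mem_set xM).
have [i' [_ fi' H']] := step_near NM' (mem_set xM).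
have -> : step N n f x = f (tau n i) by exact: (H id).
have -> : step N' n.+1 f x = f (tau n.+1 i') by exact: (H' id).
have hS : (2^-1 ^+ n.+1 : R) <= 2^-1 ^+ n.
  by rewrite exprS ler_piMl ?exprn_ge0// invf_le1// ler1n.
have : `|f (tau n.+1 i') - f (tau n i)| <= 2 * 2^-1 ^+ n.
  rewrite -(subrK (f x) (f (tau n.+1 i'))) -addrA (le_trans (ler_normD _ _))//.
  rewrite mulr_natl mulr2n lerD//; last exact: ltW.
  by rewrite distrC (le_trans (ltW fi')).
move=> H2; rewrite -(real_normK (num_real (_ - _))).
rewrite (_ : 4 * _ = (2 * 2^-1 ^+ n) ^+ 2); last by rewrite exprMn; congr (_ * _); ring.
by rewrite ler_sqr// nnegrE mulr_ge0// exprn_ge0.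
Qed.

(** The sums are integrals of step functions. The factorisation of a difference of squares bounds
    the error by 2^-n times 2 B pointwise, with B a bound of |f| on [0, M]. *)
Let step_sqr_cvg (N : nat -> nat) : (forall n, tau n (N n) = M) ->
  \sum_(i < N n) f (tau n i) ^+ 2 * (tau n i.+1 - tau n i) @[n --> \oo] -->
  \int[mu]_(x in IM) (f x ^+ 2).
Proof.
move=> NM; have [B B0 fB] := fb.
have isq : mu.-integrable IM (fun x => (f x ^+ 2)%:E).
  apply: measurable_bounded_integrable => //.
  - by rewrite [X in (X < _)%E]muM ltry.
  - apply: measurable_funX; apply: measurable_funTS; exact: continuous_measurable_fun.
  - exists (B ^+ 2); split; first exact: num_real.
    move=> r Br x; rewrite /IM/= in_itv/= => /andP[x0 xM].
    rewrite (le_trans _ (ltW Br))// normrX ler_sqr ?nnegrE//.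
    by apply: fB; rewrite x0 ltW.
apply/cvgrPdist_le => e e0.
have : M * (2 * B * 2^-1 ^+ n) @[n --> \oo] --> (0 : R).
  have -> : (0 : R) = M * (2 * B * 0) by rewrite !mulr0.
  apply: cvgM; first exact: cvg_cst.
  apply: cvgM; first exact: cvg_cst.
  by apply: cvg_expr; rewrite ger0_norm// invf_lt1// ltr1n.
move=> /cvgrPdist_le/(_ e e0); apply: filterS => n.
rewrite sub0r normrN => /(le_trans (ler_norm _)); apply: le_trans.
have [si sI] := stepint (N n) n (fun t => f t ^+ 2).
have <- : \int[mu]_(x in IM) step (N n) n (fun t => f t ^+ 2) x =
    \sum_(i < N n) f (tau n i) ^+ 2 * (tau n i.+1 - tau n i) by rewrite /Rintegral sI.
rewrite -RintegralB//.
have iB : mu.-integrable IM (EFin \o (fun x => f x ^+ 2 - step (N n) n (fun t => f t ^+ 2) x)).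
  rewrite (_ : _ \o _ = (fun x => (f x ^+ 2)%:E - (step (N n) n (fun t => f t ^+ 2) x)%:E)%E).
    exact: integrableB.
  by apply/funext => x /=; rewrite EFinB.
have := @le_normr_Rintegral _ _ _ mu IM _ mIM iB.
move=> /le_trans; apply.
have -> : M * (2 * B * 2^-1 ^+ n) = \int[mu]_(x in IM) (2 * B * 2^-1 ^+ n).
  by rewrite Rintegral_cst// [X in fine X]muM/= mulrC.
apply: le_Rintegral => //.
- exact: integrable_norm.
- apply: measurable_bounded_integrable => //.
    by rewrite [X in (X < _)%E]muM ltry.
  by exists `|2 * B * 2^-1 ^+ n|; split => // r /ltW br x _.
move=> x xM.
have [i [tM fi /(_ (fun y => y ^+ 2))]] := step_near (NM n) (mem_set xM).
rewrite [X in X = _ -> _](_ : _ = step (N n) n (fun t => f t ^+ 2) x)// => ->.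
rewrite subr_sqr normrM [leRHS]mulrC; apply: ler_pM => //; first exact: ltW.
rewrite (le_trans (ler_normD _ _))// mulr_natl mulr2n lerD// fB//.
by move: xM; rewrite /IM/= in_itv/= => /andP[-> /ltW].
Qed.

Lemma brownian_exp_karandikar_integral :
  (\int[P]_w (expR (karandikar_integral f (fun t => W t w) M))%:E =
   (expR ((\int[mu]_(x in `[0%R, M[) (f x ^+ 2)) / 2))%:E)%E.
Proof.
have /choice[N HN] : forall n, exists N, forall i, (N <= i)%N -> karandikar_time f n M i = M.
  by move=> n; exact: karandikar_time_stop.
have Ntau n : tau n (N n) = M by exact: HN.
have SE n z : karandikar_sum f z n M = karandikar_partial f z n M (N n).
  exact: karandikar_sum_stop (HN n) _ (leqnn _).
have C0 : 0 <= brownian_variance R * (4 * M).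
  by rewrite mulr_ge0 ?brownian_variance_ge0// mulr_ge0.
(* C is the isometry constant times the bound of [step_diff_sqr], and v n is the variance parameter
   of the n-th sum. The times tau depend on f only, hence are deterministic. *)
apply: (@exponential_limit _ O R P (fun n w => karandikar_sum f (fun t => W t w) n M) _
  (brownian_variance R * (4 * M)) C0 _
  (fun n => \sum_(i < N n) f (tau n i) ^+ 2 * (tau n i.+1 - tau n i))).
- move=> n; under eq_fun do rewrite SE; apply: measurable_sum => i.
  by apply: measurable_funM => //; exact: measurable_funB.
- move=> n.
  pose F z := karandikar_partial f z n.+1 M (N n.+1) - karandikar_partial f z n M (N n).
  have cF : finite_combination M F.
    by apply: finite_combinationB; exact: finite_combination_karandikar.
  under eq_integral do rewrite !SE -/(F _).
  rewrite (brownian_isometry bm cF).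
  rewrite -mulrA EFinM lee_wpmul2l//; first by rewrite lee_fin brownian_variance_ge0.
  exact: step_diff_sqr.
- exact: step_sqr_cvg.
- move=> n a; under eq_integral do rewrite SE.
  exact: (@brownian_sum_mgf R d O P W bm (tau n) (fun i => f (tau n i)) a (N n) (lexx 0)
    (karandikar_time_homo f n M0)).
Qed.

End exponential_integral.

(** * Laws of processes and Brownian scaling *)

Section path_space.
Context (R : realType) (J : pointedType).

(** Times may repeat in t, so an intersection of cylinders is obtained by concatenating the two
    families; n = 0 gives the whole space. *)
Definition cylinders : set (set (J -> R)) := [set C | exists n (t : 'I_n -> J) (A : 'I_n -> set R),
  (forall i, measurable (A i)) /\ C = [set x | forall i, A i (x (t i))]].

Lemma cylinders_setI : setI_closed cylinders.
Proof.
move=> _ _ [n1 [t1 [A1 [mA1 ->]]]] [n2 [t2 [A2 [mA2 ->]]]].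
exists (n1 + n2)%N.
exists (fun i => match fintype.split i with inl j => t1 j | inr j => t2 j end).
exists (fun i => match fintype.split i with inl j => A1 j | inr j => A2 j end).
split; first by move=> i; case: (fintype.split i).
apply/seteqP; split => x /=.
  by move=> [H1 H2] i; case: (fintype.split i).
move=> H; split => i.
  by have := H (unsplit (inl i)); rewrite unsplitK.
by have := H (unsplit (inr i)); rewrite unsplitK.
Qed.

Definition path_space := g_sigma_algebraType cylinders.

Lemma measurable_coordinate (j : J) : measurable_fun [set: path_space] (fun x : path_space => x j : R).
Proof.
move=> _ A mA; rewrite setTI; apply: sub_sigma_algebra.
exists 1%N, (fun=> j), (fun=> A); split => //.
by apply/seteqP; split => x /= ; [|apply; exact: ord0].
Qed.

Lemma measurable_to_path_space d (O : measurableType d) (X : J -> O -> R) :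
  (forall j, measurable_fun setT (X j)) ->
  measurable_fun setT (fun w => (fun j => X j w) : path_space).
Proof.
move=> mX; apply: (@measurability _ _ O path_space setT _ cylinders) => //.
move=> _ [_ [n [t [A [mA ->]]]] <-]; rewrite setTI.
rewrite (_ : _ @^-1` _ = [set w | forall i, A i (X (t i) w)])//.
apply: measurable_forall_count => i.
by rewrite -[X in measurable X]setTI; exact: mX.
Qed.

Section same_law.
Context d1 d2 (O1 : measurableType d1) (O2 : measurableType d2).
Context (P1 : probability O1 R) (P2 : probability O2 R).
Context (X1 : J -> O1 -> R) (X2 : J -> O2 -> R).
Hypotheses (mX1 : forall j, measurable_fun setT (X1 j)) (mX2 : forall j, measurable_fun setT (X2 j)).
Hypothesis same_fdd : forall n (t : 'I_n -> J) (A : 'I_n -> set R), (forall i, measurable (A i)) ->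
  P1 [set w | forall i, A i (X1 (t i) w)] = P2 [set w | forall i, A i (X2 (t i) w)].

Let mY1 := measurable_to_path_space mX1.
Let mY2 := measurable_to_path_space mX2.
Let Y1 w : path_space := fun j => X1 j w.
Let Y2 w : path_space := fun j => X2 j w.

Let nu1 : {measure set path_space -> \bar R}.
Proof. by refine (pushforward P1 Y1); exact: mY1. Defined.

Let nu2 : {measure set path_space -> \bar R}.
Proof. by refine (pushforward P2 Y2); exact: mY2. Defined.

(** Cylinders are stable under intersection and generate the sigma-algebra, so finite-dimensional
    laws determine the law. *)
Lemma same_law_set (B : set path_space) : measurable B ->
  P1 [set w | B (fun j => X1 j w)] = P2 [set w | B (fun j => X2 j w)].
Proof.
move=> mB.
apply: (@measure_unique _ R path_space cylinders (fun=> setT) erefl cylinders_setI _ _ nu1 nu2 _ _ B mB).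
- move=> _; exists 0%N, (fun=> point), (fun=> setT); split => //.
  by apply/seteqP; split.
- by apply/seteqP; split => // x _; exists 0%N.
- move=> _ [n [t [A [mA ->]]]]; exact: same_fdd.
- move=> _; have -> : nu1 setT = P1 setT by [].
  by have /= -> := probability_setT P1; rewrite ltry.
Qed.

Lemma same_law_integral (g : path_space -> R) : measurable_fun setT g -> (forall x, 0 <= g x) ->
  (\int[P1]_w (g (fun j => X1 j w))%:E = \int[P2]_w (g (fun j => X2 j w))%:E)%E.
Proof.
move=> mg g0.
have := @weighted_transfer _ _ _ path_space O1 O2 R P1 P2 Y1 Y2 (cst 1) (cst 1) mY1 mY2
  (measurable_cst _) (measurable_cst _) (fun=> ler01) (fun=> ler01) _ g mg g0.
have mul1 d (O : measurableType d) (P : probability O R) (h : O -> R) :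
    (\int[P]_w (cst 1 w * h w)%:E = \int[P]_w (h w)%:E)%E.
  by apply: eq_integral => w _; rewrite mul1r.
rewrite !mul1; apply => A mA; rewrite !mul1.
have E d (O : measurableType d) (P : probability O R) (Y : O -> path_space) :
    measurable_fun setT Y -> (\int[P]_w (\1_A (Y w))%:E = P (Y @^-1` A))%E.
  move=> mY; have mYA : measurable (Y @^-1` A) by rewrite -[X in measurable X]setTI; exact: mY.
  have := integral_indic P measurableT mYA; rewrite setIT => <-.
  by apply: eq_integral => w _; rewrite !indicE.
by rewrite !E//; exact: same_law_set.
Qed.

End same_law.
End path_space.

Section independent_same_law.
Context (R : realType) d1 d2 (O1 : measurableType d1) (O2 : measurableType d2).
Context (P1 : probability O1 R) (P2 : probability O2 R).
Context (X1 : nat -> O1 -> R) (X2 : nat -> O2 -> R).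
Hypothesis ind1 : forall N (A : nat -> set R), (forall i, measurable (A i)) ->
  P1 [set w | forall i, (i < N)%N -> A i (X1 i w)] = (\prod_(i < N) P1 [set w | A i (X1 i w)])%E.
Hypothesis ind2 : forall N (A : nat -> set R), (forall i, measurable (A i)) ->
  P2 [set w | forall i, (i < N)%N -> A i (X2 i w)] = (\prod_(i < N) P2 [set w | A i (X2 i w)])%E.
Hypothesis same : forall i (A : set R), measurable A ->
  P1 [set w | A (X1 i w)] = P2 [set w | A (X2 i w)].

Lemma independent_same_fdd n (t : 'I_n -> nat) (A : 'I_n -> set R) : (forall i, measurable (A i)) ->
  P1 [set w | forall i, A i (X1 (t i) w)] = P2 [set w | forall i, A i (X2 (t i) w)].
Proof.
move=> mA.
pose N := (\max_(i < n) t i).+1.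
(* Since t may repeat an index, B m gathers all conditions imposed on coordinate m; it is the whole
   line when there is none. *)
pose B m : set R := [set x | forall i, t i = m -> A i x].
have mB m : measurable (B m).
  rewrite (_ : B m = [set x | forall i, t i == m -> A i x]).
    by apply: measurable_forall_count => i; apply: measurable_impl; exact: mA.
  by apply/seteqP; split => x H i /eqP ?; apply: H => //; exact/eqP.
have E (O : Type) (X : nat -> O -> R) :
    [set w | forall i, A i (X (t i) w)] = [set w | forall m, (m < N)%N -> B m (X m w)].
  apply/seteqP; split => w H; first by move=> m _ i <-; exact: H.
  by move=> i; apply: (H (t i)) => //; rewrite ltnS; exact: leq_bigmax.
by rewrite !E ind1// ind2//; apply: eq_bigr => i _; exact: same.
Qed.

End independent_same_law.

Lemma normal_prob_scale (R : realType) (c s : R) (A : set R) : 0 < c -> s != 0 -> measurable A ->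
  normal_prob 0 s ((fun x => c * x) @^-1` A) = normal_prob 0 (c * s) A.
Proof.
move=> c0 s0 mA.
have cs0 : c * s != 0 by rewrite mulf_neq0// gt_eqF.
rewrite /normal_prob [RHS](ge0_integral_scale c0)//; last 2 first.
- by apply/measurable_EFinP; apply: measurable_funTS; exact: measurable_normal_pdf.
- by move=> x _; rewrite lee_fin normal_pdf_ge0.
have mcA : measurable ((fun x : R => c * x) @^-1` A).
  by rewrite -[X in measurable X]setTI; exact: mulrl_measurable.
rewrite -ge0_integralZl//; first last.
- by rewrite lee_fin ltW.
- by move=> x _; rewrite lee_fin normal_pdf_ge0.
- apply/measurable_EFinP; apply: measurable_funTS.
  apply: (@measurableT_comp _ _ _ _ _ _ (normal_pdf 0 (c * s)) setT (fun x => c * x)).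
    exact: measurable_normal_pdf.
  exact: mulrl_measurable.
apply: eq_integral => x _; rewrite -EFinM; congr EFin.
rewrite /normal_pdf (negbTE s0) (negbTE cs0) /normal_peak /normal_fun.
have -> : - (c * x - 0) ^+ 2 / ((c * s) ^+ 2 *+ 2) = - (x - 0) ^+ 2 / (s ^+ 2 *+ 2).
  by field; rewrite s0 gt_eqF.
have -> : Num.sqrt ((c * s) ^+ 2 * pi *+ 2) = c * Num.sqrt (s ^+ 2 * pi *+ 2) :> R.
  have -> : (c * s) ^+ 2 * pi *+ 2 = c ^+ 2 * (s ^+ 2 * pi *+ 2) :> R by ring.
  by rewrite sqrtrM ?sqr_ge0// sqrtr_sqr gtr0_norm.
by rewrite invfM !mulrA divff ?gt_eqF// mul1r.
Qed.

(** * Brownian scaling of bridges *)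

Section brownian_scaling.
Context (R : realType) d1 d2 (O1 : measurableType d1) (O2 : measurableType d2).
Context (P1 : probability O1 R) (P2 : probability O2 R).
Context (B1 : R -> {RV P1 >-> R}) (B2 : R -> {RV P2 >-> R}).
Hypotheses (bm1 : brownian_motion B1) (bm2 : brownian_motion B2).
Context (T : R) (T0 : 0 < T).
Let k := Num.sqrt T.
Let k0 : 0 < k. Proof. by rewrite sqrtr_gt0. Qed.

Lemma brownian_scale_increment s t (A : set R) : 0 <= s <= t -> measurable A ->
  P1 [set w | A (B1 t w - B1 s w)] = P2 [set w | A (k * (B2 (t / T) w - B2 (s / T) w))].
Proof.
move=> /andP[s0]; rewrite le_eqVlt => /predU1P[->|st] mA.
  have [A0|A0] := pselect (A 0).
    rewrite (_ : [set w | _] = setT); last by apply/seteqP; split => w //=; rewrite subrr.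
    rewrite (_ : [set w | _] = setT); last by apply/seteqP; split => w //=; rewrite subrr mulr0.
    by have /= -> := probability_setT P1; have /= -> := probability_setT P2.
  rewrite (_ : [set w | _] = set0); last by apply/seteqP; split => w //=; rewrite subrr.
  rewrite (_ : [set w | _] = set0); last by apply/seteqP; split => w //=; rewrite subrr mulr0.
  by rewrite !measure0.
rewrite (bm_increment bm1)//.
pose A' := (fun x => k * x) @^-1` A.
have mA' : measurable A'.
  by rewrite -[X in measurable X]setTI; exact: mulrl_measurable.
have stT : s / T < t / T by rewrite ltr_pM2r// invr_gt0.
have := @bm_increment _ _ _ _ _ bm2 (s / T) (t / T) A' _ stT mA'.
rewrite divr_ge0// ?(ltW T0)// => /(_ isT); rewrite /A' /= => ->.
have ts : 0 < t / T - s / T by rewrite subr_gt0.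
rewrite normal_prob_scale//; last by rewrite gt_eqF// sqrtr_gt0.
congr (normal_prob 0 _ A); rewrite /k -sqrtrM ?(ltW T0)//; congr Num.sqrt.
by field; rewrite gt_eqF.
Qed.

(** [brownian_motion] describes increments along nondecreasing times. Both bridge vectors are
    therefore written as the same linear function of increments, which are independent and have
    equal laws. *)
Lemma brownian_bridge_scale n (t : 'I_n -> R) (A : 'I_n -> set R) :
  (forall i, 0 <= t i <= T) -> (forall i, measurable (A i)) ->
  P1 [set w | forall i, A i (B1 (t i) w - t i / T * B1 T w)] =
  P2 [set w | forall i, A i (k * (B2 (t i / T) w - t i / T * B2 1 w))].
Proof.
move=> tT mA.
(* 0 is added so that values are sums of increments from the start, and T because the bridge
   involves B T. The default value T of [nth] extends the sorted list to a nondecreasing infinite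
   sequence in [0, T]. *)
pose s := sort <=%R (0 :: T :: codom t).
pose u i := nth T s i.
have sP x : (x \in s) = [|| x == 0, x == T | x \in codom t] by rewrite mem_sort !inE.
have sT x : x \in s -> 0 <= x <= T.
  rewrite sP => /or3P[/eqP ->|/eqP ->|/codomP[i ->]] //; by rewrite lexx ltW.
have srt : sorted <=%R s by apply: sort_sorted; exact: le_total.
have usT i : 0 <= u i <= T.
  rewrite /u; have [|si] := ltnP i (size s); first by move=> /(mem_nth T)/sT.
  by rewrite nth_default// lexx ltW.
have um : {homo u : i j / (i <= j)%N >-> i <= j}.
  move=> i j ij; have [js|sj] := ltnP j (size s).
    by apply: (sorted_leq_nth le_trans le_refl) => //; rewrite inE ?(leq_ltn_trans ij).
  by rewrite [leRHS]/u nth_default//; have /andP[] := usT i.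
have us x : x \in s -> u (index x s) = x by move=> xs; rewrite /u nth_index.
have u0 : u 0%N = 0.
  apply/eqP; rewrite eq_le; have /andP[-> _] := usT 0%N; rewrite andbT.
  by rewrite -[leRHS](us 0) ?um// sP eqxx.
have Ts : T \in s by rewrite sP eqxx orbT.
have ts i : t i \in s by rewrite sP codom_f !orbT.
pose X1 i w := B1 (u i.+1) w - B1 (u i) w.
pose X2 i w := k * (B2 (u i.+1 / T) w - B2 (u i / T) w).
have uT0 i : 0 <= u i / T by rewrite divr_ge0 ?(ltW T0)//; have /andP[] := usT i.
have S1 x w : x \in s -> \sum_(j < index x s) X1 j w = B1 x w.
  move=> xs; rewrite -(big_mkord xpredT (X1^~ w)) (telescope_sumr (fun j => B1 (u j) w))// us// u0.
  by rewrite (bm_start bm1) subr0.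
have S2 x w : x \in s -> \sum_(j < index x s) X2 j w = k * B2 (x / T) w.
  move=> xs; rewrite -mulr_sumr -(big_mkord xpredT (fun j => B2 (u j.+1 / T) w - B2 (u j / T) w)).
  by rewrite (telescope_sumr (fun j => B2 (u j / T) w))// us// u0 mul0r (bm_start bm2) subr0.
pose C : set (path_space R nat) := [set x : nat -> R | forall i, A i (\sum_(j < index (t i) s) x j -
  t i / T * \sum_(j < index T s) x j)].
have mC : measurable C.
  apply: measurable_forall_count => i.
  rewrite -[X in measurable X]setTI.
  have : measurable_fun [set: path_space R nat] (fun x : path_space R nat =>
      \sum_(j < index (t i) s) (x j : R) - t i / T * \sum_(j < index T s) (x j : R)).
    apply: measurable_funB; first by apply: measurable_sum => j; exact: measurable_coordinate.
    by apply: measurable_funM => //; apply: measurable_sum => j; exact: measurable_coordinate.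
  by move=> /(_ measurableT _ (mA i)).
have := @same_law_set R nat _ _ O1 O2 P1 P2 X1 X2 _ _ _ C mC.
rewrite (_ : [set w | C _] = [set w | forall i, A i (B1 (t i) w - t i / T * B1 T w)]); last first.
  by apply/seteqP; split => w /= H i; have := H i; rewrite /C !S1.
rewrite (_ : [set w | C _] = [set w | forall i, A i (k * (B2 (t i / T) w - t i / T * B2 1 w))]); last first.
  have E i w : \sum_(j < index (t i) s) X2 j w - t i / T * \sum_(j < index T s) X2 j w =
      k * (B2 (t i / T) w - t i / T * B2 1 w).
    by rewrite !S2// divff ?gt_eqF// mulrBr mulrCA.
  by apply/seteqP; split => w /= H i; have := H i; rewrite /C/= E.
apply.
- by move=> i; apply: measurable_funB; exact: measurable_funPT.
- by move=> i; apply: measurable_funM => //; apply: measurable_funB; exact: measurable_funPT.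
apply: independent_same_fdd.
- by move=> N A' mA'; apply: (bm_independent bm1) => //; rewrite u0.
- move=> N A' mA'.
  have := @bm_independent _ _ _ _ _ bm2 N (fun i => u i / T) (fun i => (fun x => k * x) @^-1` A' i).
  apply => //; last first.
    by move=> i; rewrite -[X in measurable X]setTI; exact: mulrl_measurable.
  by move=> i j ij; rewrite ler_pM2r ?invr_gt0// um.
- by move=> i A' mA'; apply: brownian_scale_increment => //; rewrite um// andbT; have /andP[] := usT i.
Qed.

End brownian_scaling.

(** * The averaged kernel *)

Section bridges.
Context (R : realType).

Definition clamp (T t : R) : R := Num.min (Num.max 0 t) T.

Lemma clamp_bounds T t : 0 <= T -> 0 <= clamp T t <= T.
Proof. by move=> T0; rewrite /clamp le_min le_max lexx T0/= ge_min lexx orbT. Qed.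

Lemma clamp_id T t : 0 <= t <= T -> clamp T t = t.
Proof. by move=> /andP[t0 tT]; rewrite /clamp max_r// min_l. Qed.

Lemma continuous_clamp T : continuous (clamp T).
Proof.
rewrite (_ : clamp T = (fun t : R^o => Num.max 0 t) \min cst T)// => t.
apply: continuous_min; last exact: cst_continuous.
by apply: (@continuous_max _ _ (cst 0) idfun t); [exact: cst_continuous|exact: cvg_id].
Qed.

Context d2 d3 (O2 : measurableType d2) (O3 : measurableType d3).
Context (P2 : probability O2 R) (P3 : probability O3 R).
Context (b2 : R -> {RV P2 >-> R}) (b3 : R -> {RV P3 >-> R}) (T : R) (T0 : 0 < T).
Hypotheses (bb2 : brownian_bridge T b2) (bb3 : brownian_bridge 1 b3).

(** Each bridge comes with its own auxiliary Brownian motion, on spaces that are unrelated;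
    [brownian_bridge_scale] compares the two. *)
Lemma bridge_same_fdd n (t : 'I_n -> R) (A : 'I_n -> set R) : (forall i, measurable (A i)) ->
  P2 [set w | forall i, A i (b2 (clamp T (t i)) w)] =
  P3 [set w | forall i, A i (Num.sqrt T * b3 (clamp T (t i) / T) w)].
Proof.
move=> mA.
have [d [U [P [B [bm fdd]]]]] := bb_law bb2.
have [e [V [Q [B' [bm' fdd']]]]] := bb_law bb3.
have ct i : 0 <= clamp T (t i) <= T by apply: clamp_bounds; exact: ltW.
rewrite (fdd n (fun i => clamp T (t i)))//.
rewrite (brownian_bridge_scale bm bm' T0)//.
have mkA i : measurable ((fun x : R => Num.sqrt T * x) @^-1` A i).
  by rewrite -[X in measurable X]setTI; exact: mulrl_measurable.
have := fdd' n (fun i => clamp T (t i) / T) (fun i => (fun x => Num.sqrt T * x) @^-1` A i).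
move=> -> //; last first.
  move=> i; have /andP[c0 cT] := ct i.
  by rewrite divr_ge0 ?(ltW T0)//= ler_pdivrMr// mul1r.
congr (Q _); apply/seteqP.
by split => w /= H i; have := H i; rewrite divr1.
Qed.

End bridges.

Section kernel_functional.
Context (R : realType).
Implicit Types (z : R -> R).
Local Notation mu := (@lebesgue_measure R).

Lemma eq_kernel_functional (beta w T : R) (W W' z z' : R -> R) :
  (forall x, 0 <= x -> W x = W' x) -> (forall t, 0 <= t <= T -> z t = z' t) ->
  kernel_functional beta w T W z = kernel_functional beta w T W' z'.
Proof.
move=> WW' zz'; rewrite /kernel_functional.
have zz t : t \in `[0, T] -> z t = z' t by rewrite in_itv/=; exact: zz'.
rewrite (eq_local_time zz).
rewrite (@eq_Rintegral _ _ _ mu `[0, T] (fun t => z' t / 2) (fun t => z t / 2)); last first.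
  by move=> t; rewrite inE/= => /zz ->.
set f := fun a => local_time z' T a / Num.sqrt beta.
by rewrite (@eq_pathwise_integral _ f f W W').
Qed.

Lemma path_bounded_support (z : R -> R) T : 0 <= T -> continuous z ->
  exists2 M, 0 <= M & forall a, M <= a -> local_time z T (Num.max 0 a) = 0.
Proof.
move=> T0 cz.
have [|c cT Hc] := @EVT_max R z 0 T T0; first exact: continuous_subspaceT.
(* The + 1 turns the maximum z c into the strict bound that [local_time_bounded_support] asks
   for. *)
exists (Num.max 0 (z c + 1)); first by rewrite le_max lexx.
move=> a; rewrite ge_max => /andP[a0 za]; rewrite max_r//.
apply: (@local_time_bounded_support _ _ _ _ (z c + 1)) => //.
  by apply: measurable_funTS; exact: continuous_measurable_fun.
by move=> t tT; rewrite (le_lt_trans (Hc t tT))// ltrDl.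
Qed.

End kernel_functional.

(** * Averaging over W for a fixed path, and Tonelli *)

Section averaged_kernel.
Context (R : realType) (beta w T : R) (beta0 : 0 < beta) (T0 : 0 < T).
Local Notation mu := (@lebesgue_measure R).

(** [kernel_functional] with the integral against W replaced by half its variance. *)
Definition averaged_functional (z : R -> R) : R :=
  expR (- (\int[mu]_(t in `[0, T]) (z t / 2))
        + (\int[mu]_(a in `[0, +oo[) (local_time z T a ^+ 2 / beta)) / 2
        - w * (local_time z T 0 / 2)).

Lemma continuous_local_time_max0 (z : R -> R) :
  continuous (fun a : R => local_time z T (Num.max 0 a) / Num.sqrt beta).
Proof.
move=> a; apply: cvgMl.
exact: ((@within_continuous_max0 R (local_time z T)).1 (@local_time_continuous R z T) a).
Qed.

Lemma kernel_functionalE (f W W' z : R -> R) :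
  (forall x, 0 <= x -> local_time z T x / Num.sqrt beta = f x) ->
  (forall x, 0 <= x -> W x = W' x) ->
  kernel_functional beta w T W z = expR (- (\int[mu]_(t in `[0, T]) (z t / 2)) +
    pathwise_integral f W' - w * (local_time z T 0 / 2)).
Proof.
move=> Hf HW; rewrite /kernel_functional.
pose g a := local_time z T a / Num.sqrt beta.
have E : pathwise_integral g W = pathwise_integral f W' by exact: eq_pathwise_integral.
by rewrite -E.
Qed.

Context d1 (O1 : measurableType d1) (P1 : probability O1 R) (W : R -> {RV P1 >-> R}).
Hypothesis bm : brownian_motion W.

(** For a fixed path only the integral against W is random. It reduces to the horizon M beyond which
    the integrand vanishes, and the resulting integral of f^2 over [0, M[ is that of L^2 / beta over
    [0, +oo[. *)
Lemma kernel_functional_expectation (z : R -> R) : continuous z ->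
  (\int[P1]_v (kernel_functional beta w T (fun a => W a v) z)%:E = (averaged_functional z)%:E)%E.
Proof.
move=> cz.
pose f a := local_time z T (Num.max 0 a) / Num.sqrt beta.
have cf : continuous f by exact: continuous_local_time_max0.
have [M M0 zM] := path_bounded_support (ltW T0) cz.
have fM x : M <= x -> f x = 0 by move=> /zM E; rewrite /f E mul0r.
have fE' x : 0 <= x -> local_time z T x / Num.sqrt beta = f x.
  by move=> x0; rewrite /f max_r.
set A := - (\int[mu]_(t in `[0, T]) (z t / 2)); set L0 := w * (local_time z T 0 / 2).
transitivity (\int[P1]_v ((expR (A - L0))%:E * (expR (karandikar_integral f (fun a => W a v) M))%:E))%E.
  apply: eq_integral => v _; rewrite -EFinM -expRD.
  rewrite (@kernel_functionalE f _ (fun a => W a v) z fE')// -/A -/L0.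
  by rewrite (pathwise_integral_support cf M0 fM) addrAC.
have mS : measurable_fun setT (fun v => (expR (karandikar_integral f (fun a => W a v) M))%:E).
  apply/measurable_EFinP; apply: measurableT_comp => //.
  apply: measurable_limn => n.
  have [N HN] := karandikar_time_stop n cf M0.
  under eq_fun do rewrite (karandikar_sum_stop _ HN (leqnn _)).
  apply: measurable_sum => i; apply: measurable_funM => //.
  by apply: measurable_funB; exact: measurable_funPT.
rewrite ge0_integralZl//.
rewrite (brownian_exp_karandikar_integral bm cf M0) -EFinM -expRD /averaged_functional.
congr (expR _)%:E; rewrite -/A -/L0 addrAC; congr (_ + _ / 2 - _).
have fE x : 0 <= x -> f x ^+ 2 = local_time z T x ^+ 2 / beta.
  by move=> x0; rewrite /f max_r// expr_div_n sqr_sqrtr// ltW.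
rewrite Rintegral_mkcond [RHS]Rintegral_mkcond; apply: eq_Rintegral => x _.
rewrite /patch !mem_setE !in_itv/= andbT; have [x0|x0] := leP 0 x => //=.
have [xM|Mx] := ltP x M; first exact: fE.
by rewrite -fE// fM// expr0n.
Qed.

Context d2 (O2 : measurableType d2) (P2 : probability O2 R) (X : R -> O2 -> R).
Hypotheses (mX : forall t, measurable_fun setT (X t)) (cX : forall v, continuous (X ^~ v)).

Let Z v t := `|X t v|.

Let cZ v : continuous (Z v).
Proof. by move=> t; apply: cvg_norm; exact: cX. Qed.

Let mZ : measurable_fun setT (fun p : O2 * R => Z p.1 p.2).
Proof.
by apply: measurableT_comp => //; exact: measurable_continuous_process.
Qed.

Let K (p : O1 * O2) := kernel_functional beta w T (fun a => W a p.1) (Z p.2).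

Let K_ge0 p : (0 <= (EFin \o K) p)%E.
Proof. by rewrite /comp lee_fin /K /kernel_functional expR_ge0. Qed.

(** Levels and times are replaced by their [Num.max 0], which makes the integrand and W continuous
    on the whole line. The functional is unchanged, as it sees only their values at nonnegative
    arguments. *)
Let mK : measurable_fun setT K.
Proof.
pose f (p : O1 * O2) a := local_time (Z p.2) T (Num.max 0 a) / Num.sqrt beta.
pose W' (p : O1 * O2) a := W (Num.max 0 a) p.1.
have mf : measurable_fun setT (fun q : (O1 * O2) * R => f q.1 q.2).
  apply: measurable_funM => //.
  apply: (@measurableT_comp _ _ _ _ _ _
    (fun p : O2 * R => local_time (Z p.1) T (Num.max 0 p.2)) setT (fun q => (q.1.2, q.2))).
    exact: measurable_local_time.
  by apply: measurable_fun_pair => //; exact: measurableT_comp.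
have mW' : measurable_fun setT (fun q : (O1 * O2) * R => W' q.1 q.2).
  apply: (@measurableT_comp _ _ _ _ _ _
    (fun p : O1 * R => W (Num.max 0 p.2) p.1) setT (fun q => (q.1.1, q.2))).
    apply: (@measurable_continuous_process _ _ R (fun t v => W (Num.max 0 t) v)).
      by move=> t; exact: measurable_funPT.
    move=> v.
    exact: ((@within_continuous_max0 R (fun t => W t v)).1 (@bm_continuous _ _ _ _ _ bm v)).
  by apply: measurable_fun_pair => //; exact: measurableT_comp.
have cf p : continuous (f p) by exact: continuous_local_time_max0.
have fM p : exists2 M, 0 <= M & forall x, M <= x -> f p x = 0.
  have [M M0 zM] := path_bounded_support (ltW T0) (@cZ p.2).
  by exists M => // x /zM E; rewrite /f E mul0r.
have mI := @measurable_pathwise_integral _ _ R f W' mf mW' cf fM.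
rewrite (_ : K = fun p => expR (- (\int[mu]_(t in `[0, T]) (Z p.2 t / 2)) +
    pathwise_integral (f p) (W' p) - w * (local_time (Z p.2) T 0 / 2))); last first.
  apply/funext => p; rewrite /K; apply: kernel_functionalE => x x0.
    by rewrite /f max_r.
  by rewrite /W' max_r.
apply: measurableT_comp => //; apply: measurable_funB.
  apply: measurable_funD => //; apply: measurable_funN.
  apply: (@measurableT_comp _ _ _ _ _ _ (fun v => \int[mu]_(t in `[0, T]) (Z v t / 2))) => //.
  apply: measurable_Rintegral_ge0 => //; first by move=> v t _; rewrite divr_ge0 // /Z.
  exact: measurable_funM.
apply: measurable_funM => //; apply: measurable_funM => //.
apply: (@measurableT_comp _ _ _ _ _ _ (fun v => local_time (Z v) T 0)) => //.
exact: measurable_local_time_at.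
Qed.

Lemma measurable_kernel_expectation :
  measurable_fun setT (fun v1 => \int[P2]_v2 (K (v1, v2))%:E)%E.
Proof.
apply: (@measurable_fun_fubini_tonelli_F _ _ O1 O2 R P2 (EFin \o K)); first exact/measurable_EFinP.
exact: K_ge0.
Qed.

Lemma kernel_expectation :
  (\int[P1]_v1 \int[P2]_v2 (kernel_functional beta w T (fun a => W a v1) (fun t => `|X t v2|%R))%:E =
   \int[P2]_v2 (averaged_functional (fun t => `|X t v2|%R))%:E)%E.
Proof.
have mEK : measurable_fun setT (EFin \o K) by exact/measurable_EFinP.
have E := @fubini_tonelli _ _ O1 O2 R P1 P2 (EFin \o K) mEK K_ge0.
transitivity (\int[P2]_y fubini_G P1 (EFin \o K) y)%E; first exact: E.
apply: eq_integral => v2 _.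
exact: (@kernel_functional_expectation (Z v2) (@cZ v2)).
Qed.

End averaged_kernel.

(** * Measurability and scaling of the averaged functional *)

Section averaged_functional_theory.
Context (R : realType).
Local Notation mu := (@lebesgue_measure R).

Lemma measurable_averaged_functional (beta w T : R) d (S : measurableType d) (Z : S -> R -> R) :
  0 < beta -> (forall s t, 0 <= Z s t) -> measurable_fun setT (fun p : S * R => Z p.1 p.2) ->
  measurable_fun setT (fun s => averaged_functional beta w T (Z s)).
Proof.
move=> beta0 Z0 mZ; apply: measurableT_comp => //; apply: measurable_funB.
  apply: measurable_funD.
    apply: measurable_funN; apply: measurable_Rintegral_ge0 => //.
      by move=> s t _; rewrite divr_ge0.
    exact: measurable_funM.
  apply: measurable_funM => //.
  rewrite (_ : (fun s => _) = fun s =>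
    \int[mu]_(a in `[0, +oo[) (local_time (Z s) T (Num.max 0 a) ^+ 2 / beta)); last first.
    apply/funext => s; apply: eq_Rintegral => a; rewrite inE/= in_itv/= andbT => a0.
    by rewrite max_r.
  apply: (@measurable_Rintegral_ge0 _ _ R
    (fun s a => local_time (Z s) T (Num.max 0 a) ^+ 2 / beta)) => //.
    by move=> s a _; rewrite divr_ge0 ?sqr_ge0// ltW.
  apply: measurable_funM => //; apply: measurable_funX.
  exact: measurable_local_time.
apply: measurable_funM => //; apply: measurable_funM => //.
exact: measurable_local_time_at.
Qed.

Lemma Rintegral_ge0_scale (c k : R) (D D' : set R) (f g : R -> R) : 0 < c -> 0 < k ->
  measurable D -> measurable D' -> (fun t => c * t) @^-1` D = D' ->
  measurable_fun D f -> measurable_fun D' g ->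
  (forall t, D t -> 0 <= f t) -> (forall t, D' t -> 0 <= g t) ->
  (forall t, D' t -> f (c * t) = k * g t) ->
  \int[mu]_(t in D) f t = c * k * \int[mu]_(t in D') g t.
Proof.
move=> c0 k0 mD mD' DD' mf mg f0 g0 fg.
rewrite /Rintegral (ge0_integral_scale c0)//; last exact/measurable_EFinP.
rewrite DD'.
rewrite (@eq_integral _ _ _ mu D' (fun t => k%:E * (g t)%:E)%E (fun t => (f (c * t))%:E)); last first.
  by move=> t; rewrite inE => D't; rewrite -EFinM -fg.
rewrite ge0_integralZl//; last 2 first.
- exact/measurable_EFinP.
- by rewrite lee_fin ltW.
rewrite muleA -EFinM.
have : (0 <= \int[mu]_(x in D') (g x)%:E)%E.
  by apply: integral_ge0 => t D't; rewrite lee_fin g0.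
(* If the integral of g is infinite, both real integrals are 0, since [fine] sends +oo to 0. *)
case: (\int[mu]_(x in D') (g x)%:E)%E => //= _.
by rewrite gt0_muley ?lte_fin ?mulr_gt0//= mulr0.
Qed.

Lemma cvg_limn_grid (x : R -> R) t : continuous x -> limn (fun n => x (grid n t)) = x t.
Proof.
move=> cx; apply/cvg_lim => //.
by apply: (@continuous_cvg _ _ _ _ _ (fun n => grid n t) x); [exact: cx|exact: cvg_grid].
Qed.

(** L^2 contributes T and the change of level T^(1/2), so the integral of L^2 and the area both
    carry T^(3/2), while the local time at 0 carries T^(1/2). *)
Lemma averaged_functional_scale (beta w T : R) (z r : R -> R) : 0 < beta -> 0 < T ->
  measurable_fun `[0, T] z -> measurable_fun `[0%R : R, 1%R : R] r ->
  (forall t, 0 <= t <= T -> 0 <= z t) -> (forall t, 0 <= t <= 1 -> 0 <= r t) ->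
  (forall t, 0 <= t <= 1 -> z (T * t) = Num.sqrt T * r t) ->
  averaged_functional beta w T z =
  expR (- (T `^ (3 / 2) / 2 * (\int[mu]_(t in `[0, 1]) r t
               - \int[mu]_(a in `[0, +oo[) (local_time r 1 a ^+ 2 / beta)))
        - T `^ (1 / 2) * w * (local_time r 1 0 / 2)).
Proof.
move=> beta0 T0 mz mr z0 r0 zr.
have k0 : 0 < Num.sqrt T by rewrite sqrtr_gt0.
have kk : Num.sqrt T * Num.sqrt T = T by rewrite -expr2 sqr_sqrtr// ltW.
have p12 : T `^ (1 / 2) = Num.sqrt T by rewrite div1r powR12_sqrt// ltW.
have p32 : T `^ (3 / 2) = T * Num.sqrt T.
  have -> : (3 / 2 : R) = 1 + 1 / 2 by field.
  by rewrite powRD ?p12 ?powRr1 ?(ltW T0)//; apply/implyP => _; rewrite gt_eqF.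
have Tk : T / Num.sqrt T = Num.sqrt T by rewrite -[X in X / _]kk mulfK// gt_eqF.
have L a : 0 <= a -> local_time z T a = Num.sqrt T * local_time r 1 (a / Num.sqrt T).
  by move=> a0; rewrite (local_time_scale k0 T0 mz mr zr a0) Tk.
have mL (y : R -> R) U : measurable_fun `[0%R : R, +oo[ (fun a => local_time y U a ^+ 2 / beta).
  apply: measurable_funM => //; apply: measurable_funX.
  apply: subspace_continuous_measurable_fun => //; exact: local_time_continuous.
have I1 : \int[mu]_(t in `[0, T]) (z t / 2) = T * (Num.sqrt T / 2) * \int[mu]_(t in `[0, 1]) r t.
  apply: Rintegral_ge0_scale => //.
  - by rewrite divr_gt0.
  - have TE t : (T * t <= T) = (t <= 1) by rewrite -{2}(mulr1 T) ler_pM2l.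
    by apply/seteqP; split => t /=; rewrite !in_itv/= pmulr_rge0// TE.
  - exact: measurable_funM.
  - by move=> t; rewrite /= in_itv/= => t01; rewrite divr_ge0// z0.
  - by move=> t; rewrite /= in_itv/= => /zr ->; rewrite mulrAC.
have I2 : \int[mu]_(a in `[0, +oo[) (local_time z T a ^+ 2 / beta) =
    Num.sqrt T * T * \int[mu]_(a in `[0, +oo[) (local_time r 1 a ^+ 2 / beta).
  apply: Rintegral_ge0_scale => //.
  - by apply/seteqP; split => t /=; rewrite !in_itv/= !andbT pmulr_rge0.
  - by move=> t _; rewrite divr_ge0 ?sqr_ge0// ltW.
  - by move=> t _; rewrite divr_ge0 ?sqr_ge0// ltW.
  - move=> t; rewrite /= in_itv/= andbT => t0; rewrite L ?mulr_ge0 ?(ltW k0)//.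
    have -> : Num.sqrt T * t / Num.sqrt T = t by rewrite mulrAC divff ?gt_eqF// mul1r.
    by rewrite exprMn sqr_sqrtr ?(ltW T0)// mulrA.
rewrite /averaged_functional I1 I2 L// mul0r p12 p32; congr expR.
by field.
Qed.

End averaged_functional_theory.

(** At x = y = 0 the two endpoints y and - y coincide: the two bridge expectations are equal and
    each has weight 1/2. *)
Lemma airy_kernel00 (R : realType) d (O : measurableType d) (P : probability O R)
    (b : R -> {RV P >-> R}) (beta w T : R) (W : R -> R) : 0 < T ->
  airy_kernel b beta w T W 0 0 = ((Num.sqrt (2 / (pi * T)))%:E *
    \int[P]_v (kernel_functional beta w T W (fun t => `|b (clamp T t) v|%R))%:E)%E.
Proof.
move=> T0; rewrite /airy_kernel /reflected_bridge_expectation.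
set h := heat_kernel T (0 - 0).
have h0 : 0 < h.
  by rewrite /h /heat_kernel divr_gt0 ?expR_gt0// sqrtr_gt0 mulr_gt0// mulr_gt0 ?pi_gt0.
have -> : heat_kernel T (0 + 0) = h by rewrite /h subr0 addr0.
have hh : h / (h + h) = 2^-1.
  move: h h0 => x x0; have -> : x + x = 2 * x by ring.
  by rewrite invfM mulrCA divff ?gt_eqF// mulr1.
have Eb y : y = 0 -> bridge_expectation b T 0 y (kernel_functional beta w T W) =
    (\int[P]_v (kernel_functional beta w T W (fun t => `|b (clamp T t) v|%R))%:E)%E.
  move=> ->; rewrite /bridge_expectation unlock; apply: eq_integral => v _.
  have H t : 0 <= t <= T -> `|0 + (0 - 0) * (t / T) + b t v| = `|b (clamp T t) v|.
    by move=> tT; rewrite clamp_id// subr0 mul0r addr0 add0r.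
  exact: (congr1 EFin (eq_kernel_functional beta w (fun x _ => erefl (W x)) H)).
rewrite hh !Eb ?oppr0// -ge0_muleDl ?lee_fin ?invr_ge0// -EFinD.
have -> : (2^-1 + 2^-1 : R) = 1 by field.
rewrite mul1e; congr (_%:E * _)%E.
have piT : 0 < 2 * pi * T by rewrite mulr_gt0// mulr_gt0 ?pi_gt0.
rewrite !addr0 expr0n/= oppr0 !mul0r expR0.
have -> : 2 / (pi * T) = 2 ^+ 2 / (2 * pi * T) :> R.
  have : pi * T != 0 :> R by rewrite gt_eqF// mulr_gt0// pi_gt0.
  by rewrite -[2 * pi * T]mulrA; move: (pi * T) => y y0; field.
by rewrite [RHS]sqrtrM ?sqr_ge0// sqrtr_sqr ger0_norm// sqrtrV ?ltW.
Qed.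

Unset Implicit Arguments.
Set Strict Implicit.
Set Printing Implicit Defensive.

Theorem proposition1p10 (R : realType)
  (* the Brownian motion W *)
  (d1 : measure_display) (Omega1 : measurableType d1)
  (P1 : probability Omega1 R) (W : R -> {RV P1 >-> R})
  (* the Brownian bridge on [0, T] defining the conditional law of R^0 *)
  (d2 : measure_display) (Omega2 : measurableType d2)
  (P2 : probability Omega2 R) (b : R -> {RV P2 >-> R})
  (* the reflected Brownian bridge r on [0, 1] *)
  (d3 : measure_display) (Omega3 : measurableType d3)
  (P3 : probability Omega3 R) (r : R -> Omega3 -> R)
  (beta T w : R) :
  0 < beta -> 0 < T ->
  brownian_motion W ->
  brownian_bridge T b ->
  reflected_brownian_bridge P3 r ->
  (\int[P1]_omega airy_kernel b beta w T (fun a => W a omega) 0 0 =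
   (Num.sqrt (2 / (pi * T)))%:E *
   'E_P3[fun omega =>
     expR (- (T `^ (3 / 2) / 2 *
              (\int[lebesgue_measure]_(t in `[0, 1]) (r t omega)
               - \int[lebesgue_measure]_(a in `[0, +oo[)
                   (local_time (fun t => r t omega) 1 a ^+ 2 / beta)))
           - T `^ (1 / 2) * w *
             (local_time (fun t => r t omega) 1 0 / 2))%R])%E.
Proof.
move=> beta0 T0 bm bb [b3 [bb3 rE]].
(* X is the given bridge and Y the bridge on [0, 1] stretched to [0, T]; clamping makes their paths
   continuous on the whole line. *)
pose X t v := b (clamp T t) v.
pose Y t v := Num.sqrt T * b3 (clamp T t / T) v.
have c01 t : 0 <= clamp T t / T <= 1.
  have /andP[c0 cT] := clamp_bounds t (ltW T0).
  by rewrite divr_ge0 ?(ltW T0)//= ler_pdivrMr// mul1r.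
have mX t : measurable_fun setT (X t) by exact: measurable_funPT.
have mY t : measurable_fun setT (Y t) by apply: measurable_funM => //; exact: measurable_funPT.
have cX v : continuous (X ^~ v).
  apply: (within_continuous_comp (@bb_continuous _ _ _ _ _ _ bb v) (@continuous_clamp R T)) => t.
  by rewrite /= in_itv/=; apply: clamp_bounds; exact: ltW.
have cY v : continuous (Y ^~ v).
  have cc : continuous (fun t => clamp T t / T).
    by move=> t; apply: cvgMl; exact: continuous_clamp.
  move=> t; apply: cvgMr.
  apply: (within_continuous_comp (@bb_continuous _ _ _ _ _ _ bb3 v) cc) => u.
  by rewrite /= in_itv/=; exact: c01.
transitivity ((Num.sqrt (2 / (pi * T)))%:E *
    \int[P1]_v1 \int[P2]_v2 (kernel_functional beta w T (fun a => W a v1) (fun t => `|X t v2|%R))%:E)%E.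
  rewrite -ge0_integralZl//.
  - by apply: eq_integral => v _; rewrite airy_kernel00.
  - exact: measurable_kernel_expectation.
  - by move=> v _; apply: integral_ge0 => v2 _; rewrite lee_fin expR_ge0.
congr (_ * _)%E; rewrite kernel_expectation// unlock.
(* On the product sigma-algebra the evaluation x t is not jointly measurable in (x, t). The limit
   along the grid is, and it recovers |x t| when x is continuous. *)
pose Z (x : path_space R R) t := `|limn (fun n => (x (grid n t) : R))|.
have mZ : measurable_fun setT (fun p : path_space R R * R => Z p.1 p.2).
  apply: measurableT_comp => //; apply: measurable_limn => n.
  apply: (@measurable_grid_process _ (path_space R R) R (fun t x => x t)) => t.
  exact: measurable_coordinate.
pose Psi x := averaged_functional beta w T (Z x).
have mPsi : measurable_fun setT Psi.
  by apply: measurable_averaged_functional => // x t; exact: normr_ge0.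
transitivity (\int[P2]_v (Psi (fun t => X t v))%:E)%E.
  apply: eq_integral => v _; congr (averaged_functional _ _ _ _)%:E.
  by apply/funext => t; rewrite /Z (cvg_limn_grid _ (cX v)).
rewrite (@same_law_integral R R _ _ Omega2 Omega3 P2 P3 X Y mX mY _ Psi mPsi); last 2 first.
- exact: bridge_same_fdd.
- by move=> x; exact: expR_ge0.
apply: eq_integral => v _; apply: (congr1 EFin).
have ZY t : Z (fun t => Y t v) t = `|Y t v| by rewrite /Z (cvg_limn_grid _ (cY v)).
(* On [0, 1], where alone r is prescribed, r is the absolute value of this continuous path; its
   measurability in t follows. *)
have cb3 : continuous (fun t => b3 (clamp 1 t) v).
  apply: (within_continuous_comp (@bb_continuous _ _ _ _ _ _ bb3 v) (@continuous_clamp R 1)) => t.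
  by rewrite /= in_itv/=; exact: clamp_bounds.
apply: averaged_functional_scale => //.
- apply: measurable_funTS; rewrite (_ : Z _ = fun t => `|Y t v|); last exact/funext.
  by apply: measurableT_comp => //; apply: continuous_measurable_fun; exact: cY.
- apply: (eq_measurable_fun (fun t => `|b3 (clamp 1 t) v|)).
    by move=> t; rewrite inE/= in_itv/= => t01; rewrite rE// clamp_id.
  apply: measurable_funTS; apply: measurableT_comp => //.
  exact: continuous_measurable_fun.
- by move=> t _; exact: normr_ge0.
- by move=> t t01; rewrite rE.
- move=> t t01; rewrite ZY /Y normrM ger0_norm ?sqrtr_ge0// rE// clamp_id.
    by rewrite mulrAC divff ?gt_eqF// mul1r.
  have /andP[t0 t1] := t01.
  by rewrite mulr_ge0 ?(ltW T0)//= -{2}(mulr1 T) ler_pM2l.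
Qed.
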